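(* Let $X=C^{2,\alpha}_{\mathrm{per}}(S^1)$, $\alpha\in(0,1)$, let $X_{\mathrm{adm}}\subset X$ be the set of admissible functions, and let $$R(q)=\sum_{p\in\widetilde P(q)}\alpha_p(q)\,\ell_p(q),\qquad q\in X_{\mathrm{adm}},$$ be the persistence-based penalty, where the augmented pair collection $\widetilde P(q)$ and lifetimes $\ell_p(q)$ are defined in the context. Then $R$ is bounded from below on $X_{\mathrm{adm}}$. Moreover, for the lifetime-dependent weight $\alpha_p(q)=\dfrac{\tau}{1+\beta\ell_p(q)}$ with $\tau,\beta>0$, $R$ is locally bounded on $X_{\mathrm{adm}}$ (for every $r>0$ there is $K(r)>0$ with $R(q)\le K(r)$ for all $q\in X_{\mathrm{adm}}$ with $\|q\|_X\le r$), and $R$ is continuous at every $q\in X_{\mathrm{adm}}$ (as a function on $X_{\mathrm{adm}}$ with the norm of $X$). The same conclusion holds for the order-dependent weight $\alpha_p(q)=(\kappa_p+1)\dfrac{\tau}{1+\beta\ell_p(q)}$, provided the order factor is uniformly bounded on bounded subsets of $X$ and the order index is locally preserved under admissible perturbations.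
   Context: **Spaces.** $X=C^{2,\alpha}_{\mathrm{per}}(S^1)=\{q\in C^{2,\alpha}([0,2\pi]): q^{(j)}(0)=q^{(j)}(2\pi),\ j=0,1,2\}$ with the $C^{2,\alpha}$ norm $\|\cdot\|_X$; functions in $X$ are viewed as functions on $S^1$. $X_{\mathrm{adm}}=\{q\in X: q$ is a Morse function on $S^1$ (all critical points nondegenerate) and its critical values are pairwise distinct$\}$. **Persistence pairs.** For $q\in X_{\mathrm{adm}}$ consider the sublevel sets $S_c=\{\theta\in S^1: q(\theta)\le c\}$, increasing in $c$. A connected component of $S_c$ is born at a local minimum $x$ of $q$ at level $c=q(x)$. When two distinct components merge at a local maximum $\tilde x$ at level $c=q(\tilde x)$, the younger one (the one whose lowest local minimum $x$ has the higher value) dies (elder rule), giving the finite $H_0$ persistence pair $(x,\tilde x)$. The component of the global minimum never dies and yields no finite pair; at the global maximum the circle closes up and no merge is recorded. $P_+(q)$ is the set of all finite $H_0$ pairs of $q$, and $P_-(q)$ is the set of all finite $H_0$ pairs obtained in the same way from $-q$. With $x_{\min},x_{\max}$ the locations of the global minimum and global maximum of $q$, set $\widetilde P(q)=P_+(q)\cup P_-(q)\cup\{(x_{\min},x_{\max})\}$. For $p=(x,\tilde x)\in\widetilde P(q)$ the lifetime is $\ell_p(q)=|q(\tilde x)-q(x)|$. **Order index.** In the order-dependent weight, $\kappa_p\in\{0,1,2,\dots\}$ is an order index assigned to each pair $p\in\widetilde P(q)$ (e.g. from a merge-tree representation). ''The order factor is uniformly bounded on bounded subsets of $X$'' means: for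 every $r>0$ there is $C_r>0$ with $\kappa_p+1\le C_r$ for all $q\in X_{\mathrm{adm}}$ with $\|q\|_X\le r$ and all $p\in\widetilde P(q)$. ''The order index is locally preserved under admissible perturbations'' means: for every $q\in X_{\mathrm{adm}}$ there is $\delta>0$ such that for all $\tilde q\in X_{\mathrm{adm}}$ with $\|\tilde q-q\|_X<\delta$, corresponding pairs of $\widetilde P(\tilde q)$ and $\widetilde P(q)$ have the same order index, where pairs correspond if their endpoints are matched under the natural correspondence of the local extrema of $\tilde q$ with the nearby local extrema of $q$ of the same type and in the same cyclic order.
   Formalization: In the first claim, ''R is bounded from below'', the unspecified weights α_p(q) are assumed nonnegative on all pairs of admissible q; for arbitrary real weights it fails (α_p = −1, q = N sin θ gives R = −2N). *)

(* Defs.v *)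
From HB Require Import structures.
From mathcomp Require Import all_boot all_order all_algebra.
From mathcomp Require Import all_classical all_reals all_analysis.

Set Implicit Arguments.
Unset Strict Implicit.
Unset Printing Implicit Defensive.

Import Order.TTheory GRing.Theory Num.Theory.
Import numFieldNormedType.Exports.

Local Open Scope ring_scope.
Local Open Scope classical_set_scope.

Section Spaces.
Variable R : realType.
Implicit Types (q : R -> R) (a : R).

(* A function on S^1 is represented by its 2pi-periodic lift to the line: the
   conditions q^(j)(0) = q^(j)(2pi), j <= 2, are exactly what makes the periodic
   extension of q : [0, 2pi] -> R twice continuously differentiable. *)

Definition holder_quotients a q : set R :=
  [set h | exists s t : R, [/\ 0 <= s <= 2 * pi, 0 <= t <= 2 * pi, s != t &
     h = `|derive1n 2 q s - derive1n 2 q t| / (`|s - t| `^ a)]].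

(* Membership in X; continuity of q'' follows from the Hoelder bound. *)
Definition inX a q : Prop :=
  [/\ periodic q (2 * pi),
      forall t, derivable q t 1,
      forall t, derivable q^`()%classic t 1 &
      has_ubound (holder_quotients a q)].

Definition sup_norm q : R := sup [set `|q t| | t in `[0, 2 * pi]%classic].

Definition normX a q : R :=
  sup_norm q + sup_norm (q^`()%classic) + sup_norm (derive1n 2 q)
  + sup (holder_quotients a q).

(* Each point of S^1 has exactly one angle in [0, 2pi[. *)
Definition angle (t : R) : Prop := 0 <= t < 2 * pi.

Definition morse q : Prop :=
  forall t, q^`()%classic t = 0 -> derive1n 2 q t != 0.

Definition distinct_critical_values q : Prop :=
  forall s t, angle s -> angle t ->
    q^`()%classic s = 0 -> q^`()%classic t = 0 -> q s = q t -> s = t.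

Definition Xadm a q : Prop :=
  [/\ inX a q, morse q & distinct_critical_values q].

End Spaces.

Section Persistence.
Variable R : realType.
Implicit Types (q : R -> R) (c x y : R).

Definition local_min q x : Prop := \forall t \near x, q x <= q t.
Definition local_max q x : Prop := \forall t \near x, q t <= q x.

(* S^1 is the unit circle of the plane, with the topology of the plane. *)
Definition circle_pt (t : R) : R * R := (cos t, sin t).

Definition sublevel q c : set (R * R) :=
  [set circle_pt t | t in [set t | q t <= c]].

Definition component q c x : set (R * R) :=
  connected_component (sublevel q c) (circle_pt x).

(* x is a local minimum, and the lowest point of its component of S_c *)
Definition lowest_min q c x : Prop :=
  [/\ local_min q x, q x <= c &
      forall y, component q c x (circle_pt y) -> q x <= q y].

(* (x, y) is a finite H_0 pair: the components of S_c with lowest minima x and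
   x' stay distinct for all levels c below q y at which both exist, and they
   merge at the local maximum y; the one of x is the younger (elder rule).  At
   the global maximum no x' exists, since S_c is then connected just below. *)
Definition H0_pairs q : set (R * R) :=
  [set p | let: (x, y) := p in
    [/\ angle x, angle y, local_max q y &
     exists x', [/\ angle x', q x' < q x < q y,
       forall c, q x <= c < q y ->
         [/\ lowest_min q c x, lowest_min q c x' &
             component q c x <> component q c x'] &
       component q (q y) x (circle_pt y) /\
       component q (q y) x' (circle_pt y)]]].

Definition global_pair q : set (R * R) :=
  [set p | let: (x, y) := p in
    [/\ angle x, angle y & forall t, q x <= q t <= q y]].

(* A set of ordered pairs: those of P_+ are (minimum, maximum) of q, those of
   P_- are (maximum, minimum) of q. *)
Definition aug_pairs q : set (R * R) :=
  H0_pairs q `|` H0_pairs (fun t => - q t) `|` global_pair q.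

Definition lifetime q (p : R * R) : R := `|q p.2 - q p.1|.

(* A sum over a set, meaningful because aug_pairs q is finite when q is
   admissible (a Morse function on the circle has finitely many critical
   points). *)
Definition penalty (w : (R -> R) -> R * R -> R) q : R :=
  \sum_(p \in aug_pairs q) (w q p * lifetime q p).

Definition lifetime_weight (tau beta : R) q (p : R * R) : R :=
  tau / (1 + beta * lifetime q p).

Definition order_weight (kappa : (R -> R) -> R * R -> nat) (tau beta : R)
    q (p : R * R) : R :=
  (kappa q p).+1%:R * (tau / (1 + beta * lifetime q p)).

End Persistence.

Section OrderIndex.
Variable R : realType.
Implicit Types (q : R -> R) (kappa : (R -> R) -> R * R -> nat).

Definition local_extrema q : set R :=
  [set x | angle x /\ (local_min q x \/ local_max q x)].

Definition arc_dist (s t : R) : R := Num.min `|s - t| (2 * pi - `|s - t|).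

(* For angles in [0, 2pi[: s, t, u are met in this order when turning once
   around the circle from s. *)
Definition cyclic (s t u : R) : Prop :=
  [\/ s < t < u, t < u < s | u < s < t].

Definition extrema_correspondence (rho : R) q q' (f : R -> R) : Prop :=
  [/\ set_bij (local_extrema q) (local_extrema q') f,
      forall x, local_extrema q x -> local_min q x -> local_min q' (f x),
      forall x, local_extrema q x -> local_max q x -> local_max q' (f x),
      forall x y z, local_extrema q x -> local_extrema q y ->
        local_extrema q z -> cyclic x y z -> cyclic (f x) (f y) (f z) &
      forall x, local_extrema q x -> arc_dist x (f x) < rho].

(* rho quantifies nearby: the property only becomes weaker as rho and delta
   shrink, and the correspondence is unique once rho is small enough. *)
Definition order_locally_preserved (a : R) kappa : Prop :=
  forall q, Xadm a q -> exists rho delta : R, [/\ 0 < rho, 0 < delta &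
    forall q', Xadm a q' -> normX a (fun t => q' t - q t) < delta ->
    forall f, extrema_correspondence rho q q' f ->
    forall x y, aug_pairs q (x, y) -> aug_pairs q' (f x, f y) ->
      kappa q' (f x, f y) = kappa q (x, y)].

Definition order_factor_bounded (a : R) kappa : Prop :=
  forall r : R, 0 < r -> exists2 C : R, 0 < C &
    forall q, Xadm a q -> normX a q <= r ->
    forall p, aug_pairs q p -> (kappa q p).+1%:R <= C.

End OrderIndex.

Section Conclusions.
Variable R : realType.
Implicit Types (a : R) (F : (R -> R) -> R).

Definition bounded_below a F : Prop :=
  exists m : R, forall q, Xadm a q -> m <= F q.

Definition locally_bounded a F : Prop :=
  forall r : R, 0 < r -> exists2 K : R, 0 < K &
    forall q, Xadm a q -> normX a q <= r -> F q <= K.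

Definition continuous_on_Xadm a F : Prop :=
  forall q, Xadm a q -> forall e : R, 0 < e -> exists2 delta : R, 0 < delta &
    forall q', Xadm a q' -> normX a (fun t => q' t - q t) < delta ->
      `|F q' - F q| < e.

End Conclusions.

(* Main.v *)
(* The pairs of an admissible [q] are determined by the combinatorics of its
   critical points on the line: their order, the order of their values, their
   types and the translation by 2 pi. Indeed, a component of a sublevel set of
   the circle is an arc, and whether an arc stays below a level is decided at
   its critical points.

   Continuity. A Morse function has |q'| + |q''| bounded below, so a
   C^2-small perturbation moves each critical point slightly, neither creating
   nor destroying any, and preserves all this combinatorial data because the
   finitely many critical values are separated. The pairs of the two functions
   thus correspond, and each term of the penalty is Lipschitz in the lifetime.

   Local bound. On the circle cut at a global maximum, the component in
   {q < q y} of the minimum of a pair (x, y) is an arc. These arcs are nested or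
   disjoint, and an arc does not meet the minima of the larger ones. Hence twice
   the sum of the lifetimes is at most the total variation of [q], which is
   bounded by 2 pi times the supremum of |q'|. *)
Require Import Defs.
From HB Require Import structures.
From mathcomp Require Import all_boot all_order all_algebra.
From mathcomp Require Import all_classical all_reals all_analysis.
From mathcomp Require Import ring lra zify.
Set Implicit Arguments.
Unset Strict Implicit.
Unset Printing Implicit Defensive.

Import Order.TTheory GRing.Theory Num.Theory.
Import numFieldNormedType.Exports.
Local Open Scope ring_scope.
Local Open Scope classical_set_scope.

(** * Arcs and components on the circle *)

(** [H0_pairs] speaks of components of plane sets at a continuum of levels, whereas a perturbation
    estimate controls critical points only. Two reductions bridge this gap. First, the levels below
    the death level [q y] are replaced by the single strict sublevel set at [q y]: by compactness an
    arc strictly below [q y] already lies below a smaller level. Second, the elder rule compares a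
    minimum with all points of its component, critical or not; a point lower than the minimum is
    pushed down, inside the same arc, to a lower local minimum, so that critical competitors
    suffice. The lift to the line turns cyclic order into linear order together with equivariance
    under [turn]; angles return through [wrap] where the definitions ask for them. In the local
    bound the elder rule enters at one place: it excludes that an arc contains the minimum of a
    different pair of at least the same death level. The lifetime-dependent weight is the
    order-dependent one with constant index 0, for which both hypotheses on the index are
    immediate. *)

Section Circle.
Context {R : realType}.
Implicit Types (q : R -> R) (s t u x y c : R) (k : int).

Local Notation T := (2 * pi : R).

Lemma twopi_gt0 : 0 < T.
Proof. by rewrite mulr_gt0 // pi_gt0. Qed.

Definition turn k t : R := t + T * k%:~R.

Lemma turnD k l t : turn k (turn l t) = turn (k + l) t.
Proof. by rewrite /turn rmorphD /=; ring. Qed.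

Lemma turn0 t : turn 0 t = t.
Proof. by rewrite /turn mulr0 addr0. Qed.

Lemma turnK k : cancel (turn k) (turn (- k)).
Proof. by move=> t; rewrite turnD addNr turn0. Qed.

Lemma periodic_turn q : periodic q T -> forall k t, q (turn k t) = q t.
Proof.
move=> qT; have qn (n : nat) t : q (t + T * n%:R) = q t.
  elim: n t => [|n IH] t; first by rewrite mulr0 addr0.
  have -> : t + T * n.+1%:R = t + T * n%:R + T by rewrite -[n.+1%:R]natr1; ring.
  by rewrite qT IH.
move=> [n|n] t; rewrite /turn; first exact: qn.
by rewrite NegzE mulrNz mulrN -(qn n.+1) subrK.
Qed.

Definition wrap t : R := turn (- Num.floor (t / T)) t.

Lemma angle_wrap t : angle (wrap t).
Proof.
have T0 := twopi_gt0.
have /andP[h1 h2] := floor_itv (t / T).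
move: h1 h2; rewrite ler_pdivlMr // ltr_pdivrMr // rmorphD /= /angle /wrap.
by rewrite /turn mulrNz => h1 h2; apply/andP; split; lra.
Qed.

Lemma wrapE t : exists k, wrap t = turn k t.
Proof. by eexists. Qed.

Lemma angle_turn_eq k s t : angle s -> angle t -> s = turn k t -> s = t.
Proof.
have T0 := twopi_gt0; move=> /andP[s0 s1] /andP[t0 t1] e.
suff k0 : k = 0 by rewrite e k0 turn0.
have h1 : (-1 : R) < k%:~R.
  by rewrite -(ltr_pM2l T0); move: e; rewrite /turn; lra.
have h2 : k%:~R < (1 : R).
  by rewrite -(ltr_pM2l T0); move: e; rewrite /turn; lra.
have {}h1 : -1 < k by rewrite -(@ltr_int R).
have {}h2 : k < 1 by rewrite -(@ltr_int R).
by lia.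
Qed.

Lemma lift_from s t : exists k, s <= turn k t < s + T.
Proof.
have [k e] := wrapE (t - s); have := angle_wrap (t - s).
by rewrite e => /andP[h1 h2]; exists k; rewrite /turn in h1 h2 *; apply/andP; split; lra.
Qed.

Lemma cos_sin_turn k t : cos (turn k t) = cos t /\ sin (turn k t) = sin t.
Proof.
have T2 : T = pi *+ 2 by rewrite mulr_natl.
by split; apply: periodic_turn => u; rewrite T2 ?cosD2pi ?sinD2pi.
Qed.

Lemma circle_pt_turn k t : circle_pt (turn k t) = circle_pt t.
Proof. by rewrite /circle_pt; have [-> ->] := cos_sin_turn k t. Qed.

Lemma sin_eq0_small t : - pi < t < pi -> sin t = 0 -> t = 0.
Proof.
move=> /andP[h1 h2] e; case: (ltgtP t 0) => // h.
- have : 0 < sin (- t) by apply: sin_gt0_pi; apply/andP; split; lra.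
  by rewrite sinN e oppr0 ltxx.
- have : 0 < sin t by apply: sin_gt0_pi; apply/andP; split; lra.
  by rewrite e ltxx.
Qed.

Lemma circle_pt_inj s t : circle_pt s = circle_pt t -> exists k, s = turn k t.
Proof.
move=> [ec es]; have [k kE] := wrapE (s - t).
have /andP[w0 wT] := angle_wrap (s - t).
have : cos (wrap (s - t)) = 1.
  by rewrite kE; have [-> _] := cos_sin_turn k (s - t); rewrite cosB ec es -!expr2 cos2Dsin2.
set w := wrap _ in kE w0 wT * => cw.
(* The sine of [w] itself has two zeros in [0, 2pi[; [w / 2] lies in [0, pi[, where 0 is the only
   one. *)
have s0 : sin (w / 2) = 0.
  have := cosD (w / 2) (w / 2); rewrite -splitr cw -!expr2 cos2sin2 => e.
  by apply/eqP; rewrite -sqrf_eq0; apply/eqP; lra.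
have : w / 2 = 0.
  by apply: sin_eq0_small s0; have T0 := twopi_gt0; apply/andP; split; lra.
move=> w00; exists (- k).
have w1 : w = 0 by lra.
by move: kE; rewrite w1 /turn mulrNz; lra.
Qed.

Lemma sublevel_circle_pt q c t : periodic q T -> sublevel q c (circle_pt t) -> q t <= c.
Proof. by move=> qT [s /= qs /circle_pt_inj[k e]]; move: qs; rewrite e periodic_turn. Qed.

Definition between x y t : Prop := x <= t <= y \/ y <= t <= x.

(* [x] is joined to some lift of [y] by an arc on which [P] holds *)
Definition joined (P : R -> Prop) x y : Prop :=
  exists k, forall t, between x (turn k y) t -> P t.

Lemma continuous_circle_pt : continuous (@circle_pt R).
Proof.
by move=> t; apply: (cvg_pair (@continuous_cos R t) (@continuous_sin R t)).
Qed.

Lemma joined_component q c x y :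
  joined (fun t => q t <= c) x y -> component q c x (circle_pt y).
Proof.
move=> [k h]; rewrite -(circle_pt_turn k y).
have key a b : a <= b -> (forall t, a <= t <= b -> q t <= c) ->
    forall u v, a <= u <= b -> a <= v <= b -> component q c u (circle_pt v).
  move=> ab hab u v uab vab.
  have sub : (@circle_pt R) @` `[a, b] `<=` connected_component (sublevel q c) (circle_pt u).
    apply: connected_component_max.
    - by exists u => //=; rewrite in_itv.
    - by move=> _ [w /= wab <-]; exists w => //=; apply: hab; rewrite in_itv in wab.
    - apply: connected_continuous_connected; first exact: segment_connected.
      by apply: continuous_subspaceT; apply: continuous_circle_pt.
  by apply: sub; exists v => //=; rewrite in_itv.
have [l|/ltW l] := leP x (turn k y).
  by apply: (key _ _ l); rewrite ?lexx ?l // => t tt; apply: h; left.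
by apply: (key _ _ l); rewrite ?lexx ?l // => t tt; apply: h; right.
Qed.

(* Two points [s], [t] of the circle outside the set are the zeros of the
   affine function of the chord through them, which separates the two arcs. *)
Lemma component_joined q c x y : periodic q T ->
  component q c x (circle_pt y) -> joined (fun t => q t <= c) x y.
Proof.
have T0 := twopi_gt0; move=> qT cxy.
have qx : q x <= c.
  apply: (sublevel_circle_pt qT); apply: contrapT => nx.
  by move: cxy; rewrite /component connected_component_out.
have qy : q y <= c.
  by apply: (sublevel_circle_pt qT); apply: connected_component_sub cxy.
have [k /andP[k1 k2]] := lift_from x y.
apply: contrapT => nj.
have [s s1 s2] : exists2 s, x <= s <= turn k y & c < q s.
  apply: contrapT => ns; apply: nj; exists k => t [tb|tb].
    by rewrite leNgt; apply/negP => ct; apply: ns; exists t.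
  have -> : t = x by apply/eqP; rewrite eq_le; apply/andP; split; lra.
  exact: qx.
(* The complementary arc runs from [x] down to [turn (k - 1) y]; shifted by one turn it lies between
   [turn k y] and [x + T]. *)
have [t t1 t2] : exists2 t, turn k y <= t <= x + T & c < q t.
  apply: contrapT => ns; apply: nj; exists (k - 1) => t [tb|tb].
    move: tb; rewrite /turn rmorphB /= in k1 k2 *; move=> tb.
    have -> : t = x by apply/eqP; rewrite eq_le; apply/andP; split; lra.
    exact: qx.
  rewrite leNgt; apply/negP => ct; apply: ns; exists (t + T); last by rewrite qT.
  by move: tb; rewrite /turn rmorphB /= => tb; apply/andP; split; lra.
have qky : q (turn k y) <= c by rewrite periodic_turn.
have sx : x < s by move: s1 => /andP[]; rewrite le_eqVlt => /orP[/eqP e|//]; move: s2; rewrite -e ltNge qx.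
have sy : s < turn k y.
  by move: s1 => /andP[_]; rewrite le_eqVlt => /orP[/eqP e|//]; move: s2; rewrite e ltNge qky.
have ty : turn k y < t.
  by move: t1 => /andP[]; rewrite le_eqVlt => /orP[/eqP e|//]; move: t2; rewrite -e ltNge qky.
have tx : t < x + T.
  by move: t1 => /andP[_]; rewrite le_eqVlt => /orP[/eqP e|//]; move: t2; rewrite e qT ltNge qx.
pose m := (s + t) / 2.
pose phi (p : R * R) : R := p.1 * cos m + p.2 * sin m - cos ((t - s) / 2).
(* The product form displays the signs: negative at [x], which precedes [s], and positive at [y],
   which lies between [s] and [t]. *)
have phiE w : phi (circle_pt w) = 2 * (sin ((w - s) / 2) * sin ((t - w) / 2)).
  rewrite /phi /= -cosB.
  have -> : w - m = (w - s) / 2 - (t - w) / 2 by rewrite /m; field.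
  have -> : (t - s) / 2 = (w - s) / 2 + (t - w) / 2 by field.
  by rewrite cosB cosD; ring.
have cphi : continuous phi.
  move=> p; rewrite /phi; apply: cvgB; last exact: cvg_cst.
  by apply: cvgD; apply: cvgM; (exact: cvg_cst || exact: cvg_fst || exact: cvg_snd).
have cC : connected (phi @` component q c x).
  apply: connected_continuous_connected; first exact: component_connected.
  exact: continuous_subspaceT.
have /connected_intervalP iC := cC.
have [p Cp p0] : (phi @` component q c x) 0.
  apply: (iC (phi (circle_pt x)) (phi (circle_pt y))).
  - by exists (circle_pt x) => //; apply: connected_component_refl; exists x.
  - by exists (circle_pt y).
  - rewrite -(circle_pt_turn k y) !phiE; apply/andP; split.
      rewrite pmulr_rle0 //.
      rewrite nmulr_rle0; first by apply/ltW/sin_gt0_pi/andP; split; lra.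
      have -> : (x - s) / 2 = - ((s - x) / 2) by field.
      by rewrite sinN oppr_lt0; apply/sin_gt0_pi/andP; split; lra.
    by rewrite pmulr_rge0 // mulr_ge0 //; apply/ltW/sin_gt0_pi/andP; split; lra.
have /= [w qw wp] := connected_component_sub Cp.
(* With the lift of [w] in [s, s + T[ both half-differences lie in ]-pi, pi[, where the sine
   vanishes only at 0. *)
have [l /andP[l1 l2]] := lift_from s w.
have qlw : q (turn l w) <= c by rewrite periodic_turn.
move: p0; rewrite -wp -(circle_pt_turn l) phiE => /eqP.
rewrite !mulf_eq0 pnatr_eq0 /= => /orP[] /eqP /sin_eq0_small e.
  have : (turn l w - s) / 2 = 0 by apply: e; apply/andP; split; lra.
  move=> e'; have e2 : turn l w = s by lra.
  by move: s2; rewrite -e2 ltNge qlw.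
have : (t - turn l w) / 2 = 0 by apply: e; apply/andP; split; lra.
move=> e'; have e2 : turn l w = t by lra.
by move: t2; rewrite -e2 ltNge qlw.
Qed.

End Circle.

(** * Local extrema *)

Section LocalExtrema.
Context {R : realType}.
Implicit Types (q h : R -> R) (s t u v x y c d : R) (k : int).

Local Notation T := (2 * pi : R).

Lemma local_minP q x : local_min q x <->
  exists2 e, 0 < e & forall t, `|t - x| < e -> q x <= q t.
Proof.
split=> [/nbhs_ballP[e /= e0 h]|[e e0 h]].
  by exists e => // t te; apply: h; rewrite /ball /= distrC.
by apply/nbhs_ballP; exists e => // t; rewrite /ball /= distrC => /h.
Qed.

Lemma local_minN q x : local_min (fun t => - q t) x <-> local_max q x.
Proof. by split; apply: filterS => t; rewrite lerN2. Qed.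

Lemma local_maxN q x : local_max (fun t => - q t) x <-> local_min q x.
Proof. by split; apply: filterS => t; rewrite lerN2. Qed.

Lemma local_min_turn q k x : periodic q T -> local_min q x -> local_min q (turn k x).
Proof.
move=> qT /local_minP[e e0 h]; apply/local_minP; exists e => // t te.
rewrite periodic_turn // -(periodic_turn qT (- k) t); apply: h.
by move: te; rewrite /turn mulrNz; congr (`|_| < _); ring.
Qed.

Lemma local_max_turn q k x : periodic q T -> local_max q x -> local_max q (turn k x).
Proof.
move=> qT /local_minN h; apply/local_minN; apply: local_min_turn => //.
by move=> t; rewrite qT.
Qed.

Lemma local_min_opp q x : local_min (fun t => q (- t)) x -> local_min q (- x).
Proof.
move=> /local_minP[e e0 h]; apply/local_minP; exists e => // t te.
rewrite -(opprK t); apply: h.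
by rewrite -normrN opprD opprK.
Qed.

Definition crit q x : Prop := q^`()%classic x = 0.

Lemma crit_local_min q x : (forall t, derivable q t 1) -> local_min q x -> crit q x.
Proof.
move=> dq /local_minP[e e0 h].
have dx : is_derive x 1 q 0.
  apply: (@derive1_at_min _ q (x - e) (x + e)) => //; first by lra.
    by rewrite in_itv /=; apply/andP; split; lra.
  by move=> t; rewrite in_itv /= => /andP[t1 t2]; apply: h; rewrite ltr_norml; apply/andP; split; lra.
by rewrite /crit derive1E; case: dx.
Qed.

Lemma derive1_opp q x : (forall t, derivable q t 1) ->
  (fun t => - q t)^`()%classic x = - q^`()%classic x.
Proof. by move=> dq; rewrite !derive1E deriveN. Qed.

Lemma critN q x : (forall t, derivable q t 1) -> crit (fun t => - q t) x <-> crit q x.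
Proof.
move=> dq; rewrite /crit derive1_opp //; split => [/eqP|->]; last by rewrite oppr0.
by rewrite oppr_eq0 => /eqP.
Qed.

Lemma derivable_opp q : (forall t, derivable q t 1) -> forall t, derivable (fun t => - q t) t 1.
Proof. by move=> dq t; apply: derivableN. Qed.

Lemma crit_local_max q x : (forall t, derivable q t 1) -> local_max q x -> crit q x.
Proof.
by move=> dq /local_minN h; apply/critN => //; apply: crit_local_min => //; apply: derivable_opp.
Qed.

Lemma periodic_derive1 q : periodic q T -> periodic q^`()%classic T.
Proof.
move=> qT t; rewrite !derive1E /derive.
have -> : q \o +%R^~ (t + T) = q \o +%R^~ t.
  by apply/funext => z /=; rewrite addrA qT.
by rewrite qT.
Qed.

Lemma crit_turn q k x : periodic q T -> crit q (turn k x) <-> crit q x.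
Proof. by move=> qT; rewrite /crit periodic_turn //; apply: periodic_derive1. Qed.

Lemma derivable_continuous q : (forall t, derivable q t 1) -> continuous q.
Proof. by move=> dq t; apply: differentiable_continuous; apply/derivable1_diffP. Qed.

Lemma max_segment q a b : (forall t, derivable q t 1) -> a <= b -> crit q a -> crit q b ->
  exists c, [/\ crit q c, a <= c <= b & forall t, a <= t <= b -> q t <= q c].
Proof.
move=> dq ab ca cb; have cq := derivable_continuous dq.
have [c] := EVT_max ab (continuous_subspaceT cq).
rewrite in_itv /= => /andP[ac cb'] h; exists c; split; [|exact/andP|]; last first.
  by move=> t tt; apply: h; rewrite in_itv.
have [->//|nea] := eqVneq c a; have [->//|neb] := eqVneq c b.
have {}ac : a < c by rewrite lt_neqAle eq_sym nea.
have {}cb' : c < b by rewrite lt_neqAle neb.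
have dx : is_derive c 1 q 0.
  apply: (@derive1_at_max _ q a b) => //; first by rewrite in_itv /=; apply/andP.
  by move=> t; rewrite in_itv /= => /andP[t1 t2]; apply: h; rewrite in_itv /=; apply/andP; split; lra.
by rewrite /crit derive1E; case: dx.
Qed.

Lemma first_reach h a b d : continuous h -> a <= b -> h a < d -> d <= h b ->
  exists v, [/\ a < v <= b, h v = d & forall s, a <= s < v -> h s < d].
Proof.
move=> ch ab had hbd.
pose S := [set s | a <= s <= b /\ d <= h s].
have Sb : S b by split; rewrite ?ab ?lexx.
have lS : has_lbound S by exists a => s [/andP[]].
have iS : has_inf S by split => //; exists b.
have av : a <= inf S by apply: lb_le_inf => [|s [/andP[]]//]; exists b.
have vb : inf S <= b by apply: ge_inf.
have below s : a <= s < inf S -> h s < d.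
  move=> /andP[as_ sv]; rewrite ltNge; apply/negP => ds.
  suff : inf S <= s by rewrite leNgt sv.
  by apply: ge_inf => //; split => //; apply/andP; split; lra.
have hv : d <= h (inf S).
  rewrite leNgt; apply/negP => hv.
  have : \forall t \near inf S, h t < d by exact: (cvgr_lt _ (ch _) _ hv).
  move=> /nbhs_ballP[e /= e0 he].
  have [s Ss se] := inf_adherent e0 iS.
  have vs : inf S <= s by apply: ge_inf.
  have : h s < d by apply: he; rewrite /ball /= ltr_norml; apply/andP; split; lra.
  by case: Ss => _; rewrite leNgt => /negP.
(* Equality at [inf S] comes from the intermediate value theorem: a point of height [d] exists in
   [a, inf S], and no earlier point reaches [d]. *)
have hd : Num.min (h a) (h (inf S)) <= d <= Num.max (h a) (h (inf S)).
  by rewrite ge_min le_max (ltW had) hv orbT.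
have [c] := IVT av (continuous_subspaceT ch) hd.
rewrite in_itv /= => /andP[c1 c2] hc.
have cE : c = inf S.
  apply/eqP; rewrite eq_le c2 leNgt; apply/negP => lt; move: (below c).
  by rewrite hc ltxx c1 lt => /(_ isT).
exists (inf S); split => //; last by rewrite -cE.
apply/andP; split => //; rewrite lt_neqAle av andbT; apply/eqP => e.
by move: had; rewrite e -cE hc ltxx.
Qed.

Lemma last_reach h a b d : continuous h -> a <= b -> h b < d -> d <= h a ->
  exists v, [/\ a <= v < b, h v = d & forall s, v < s <= b -> h s < d].
Proof.
move=> ch ab hbd had.
have ch' : continuous (fun t => h (- t)).
  by move=> t; apply: continuous_comp; [exact: opp_continuous | exact: ch].
have := @first_reach (fun t => h (- t)) (- b) (- a) d ch'; rewrite !opprK lerN2.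
move=> /(_ ab hbd had)[v [/andP[v1 v2] hv hs]]; exists (- v); split => //.
  by apply/andP; split; lra.
by move=> s /andP[s1 s2]; rewrite -(opprK s); apply: hs; apply/andP; split; lra.
Qed.

(** The barrier [y] supplies a first point [v] of height [d] after [b]. Both ends of [a, v] are
    higher than [h b], so the minimum over this window is interior, hence a local minimum. *)
Lemma descend_right h a b y d : continuous h -> a <= b -> b <= y ->
    (forall s, a <= s <= b -> h s < d) -> h b < h a -> d <= h y ->
  exists c, [/\ local_min h c, a <= c, h c < h a & forall s, a <= s <= c -> h s < d].
Proof.
move=> ch ab b_y hd hba hy.
have hbd : h b < d by apply: hd; rewrite ab lexx.
have [v [/andP[bv _] hv hs]] := first_reach ch b_y hbd hy.
have av : a <= v by lra.
have had : h a < d by apply: hd; rewrite lexx.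
have hd' s : a <= s < v -> h s < d.
  move=> /andP[s1 s2]; have [sb|bs] := leP s b; first by apply: hd; rewrite s1.
  by apply: hs; rewrite (ltW bs).
have [c] := EVT_min av (continuous_subspaceT ch).
rewrite in_itv /= => /andP[ac cv] hc.
have cb : h c <= h b by apply: hc; rewrite in_itv /= ab ltW.
have {}ac : a < c.
  rewrite lt_neqAle ac andbT; apply/eqP => e; move: hba; rewrite e; lra.
have {}cv : c < v.
  rewrite lt_neqAle cv andbT; apply/eqP => e; have := hd b; rewrite ab lexx => /(_ isT).
  by rewrite -hv -e; lra.
exists c; split; [|by lra|by lra|]; last first.
  by move=> s /andP[s1 s2]; apply: hd'; apply/andP; split; lra.
apply/local_minP; exists (Num.min (c - a) (v - c)); first by rewrite lt_min; apply/andP; split; lra.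
move=> t; rewrite lt_min !ltr_norml => /andP[/andP[t1 t2] /andP[t3 t4]].
by apply: hc; rewrite in_itv /=; apply/andP; split; lra.
Qed.

Lemma descend_left h a b y d : continuous h -> b <= a -> y <= b ->
    (forall s, b <= s <= a -> h s < d) -> h b < h a -> d <= h y ->
  exists c, [/\ local_min h c, c <= a, h c < h a & forall s, c <= s <= a -> h s < d].
Proof.
move=> ch ba yb hd hba hy.
have ch' : continuous (fun t => h (- t)).
  by move=> t; apply: continuous_comp; [exact: opp_continuous | exact: ch].
have := @descend_right (fun t => h (- t)) (- a) (- b) (- y) d ch'.
rewrite !opprK !lerN2 => /(_ ba yb _ hba hy)[|c [mc ac hc hs]].
  by move=> s /andP[s1 s2]; apply: hd; apply/andP; split; lra.
exists (- c); split => //; first exact: local_min_opp; first by lra.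
by move=> s /andP[s1 s2]; rewrite -(opprK s); apply: hs; apply/andP; split; lra.
Qed.

End LocalExtrema.

(** * The elder rule at critical points *)

Section ElderRule.
Context {R : realType}.
Implicit Types (q : R -> R) (s t u v x y c d : R) (k : int).

Local Notation T := (2 * pi : R).

(** Used with the death level for [d]: it gathers the condition of [lowest_min] at all levels below
    [d]. That the two components of a pair are distinct then follows from the inequality between
    their lowest values. *)
Definition lowest_below q d x : Prop :=
  forall t, joined (fun s => q s < d) x t -> q x <= q t.

Definition elder_pair q x y : Prop :=
  [/\ local_min q x, local_max q y &
   exists x', [/\ local_min q x', q x' < q x < q y,
     lowest_below q (q y) x, lowest_below q (q y) x' &
     joined (fun s => q s <= q y) x y /\ joined (fun s => q s <= q y) x' y]].

Lemma between_turn k x y t : between (turn k x) y t <-> between x (turn (- k) y) (turn (- k) t).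
Proof.
rewrite /between /turn mulrNz mulrN.
by split=> -[/andP[? ?]|/andP[? ?]]; [left|right|left|right]; apply/andP; split; lra. Qed.

Lemma joined_turnl (P : R -> Prop) k x y : (forall j t, P (turn j t) <-> P t) ->
  joined P (turn k x) y <-> joined P x y.
Proof.
have key j u : (forall j t, P (turn j t) <-> P t) -> joined P (turn j u) y -> joined P u y.
  move=> PT [i h]; exists (i - j) => t tt; apply/(PT j); apply: h.
  by apply/between_turn; rewrite turnK turnD addrC.
move=> PT; split; first exact: key.
by rewrite -{1}(turnK k x); apply: key.
Qed.

Lemma joined_turnr (P : R -> Prop) k x y : joined P x (turn k y) <-> joined P x y.
Proof.
split=> -[j h]; first by exists (j + k); rewrite -turnD.
by exists (j - k); rewrite turnD subrK.
Qed.

Lemma sub_joined (P Q : R -> Prop) x y : (forall t, P t -> Q t) -> joined P x y -> joined Q x y.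
Proof. by move=> PQ [k h]; exists k => t tt; apply/PQ/h. Qed.

(** The maximum over a compact arc is attained. This converts the strict sublevel set at [d] into
    levels [c < d], and [q x <= c] makes [c] a level at which [x] is already born. *)
Lemma joined_lt_max q x y d : continuous q -> joined (fun s => q s < d) x y ->
  exists2 c, q x <= c < d & joined (fun s => q s <= c) x y.
Proof.
move=> cq [k h].
have [l|/ltW l] := leP x (turn k y).
  have [m] := EVT_max l (continuous_subspaceT cq); rewrite in_itv /= => mm hm.
  exists (q m).
    rewrite h ?andbT; last by left.
    by apply: hm; rewrite in_itv /= lexx.
  exists k => t [tt|/andP[t1 t2]]; first by apply: hm; rewrite in_itv.
  by apply: hm; rewrite in_itv /=; apply/andP; split; lra.
have [m] := EVT_max l (continuous_subspaceT cq); rewrite in_itv /= => mm hm.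
exists (q m).
  rewrite h ?andbT; last by right.
  by apply: hm; rewrite in_itv /= lexx l.
exists k => t [/andP[t1 t2]|tt]; last by apply: hm; rewrite in_itv.
by apply: hm; rewrite in_itv /=; apply/andP; split; lra.
Qed.

Lemma component_wrap q c x : component q c (wrap x) = component q c x.
Proof. by rewrite /component /wrap circle_pt_turn. Qed.

Lemma lowest_min_wrap q c x : periodic q T -> lowest_min q c (wrap x) <-> lowest_min q c x.
Proof.
move=> qT; have [k ->] := wrapE x; rewrite /lowest_min /component !circle_pt_turn periodic_turn //.
split=> -[m h1 h2]; split => //; last exact: local_min_turn.
by rewrite -(turnK k x); apply: local_min_turn.
Qed.

Lemma elder_pair_turn q k l x y : periodic q T ->
  elder_pair q (turn k x) (turn l y) <-> elder_pair q x y.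
Proof.
move=> qT; have key i j u v : elder_pair q u v -> elder_pair q (turn i u) (turn j v).
  have lT (d : R) (i' : int) (t : R) : q (turn i' t) < d <-> q t < d by rewrite periodic_turn.
  have leT (d : R) (i' : int) (t : R) : q (turn i' t) <= d <-> q t <= d by rewrite periodic_turn.
  move=> [mu mv [w [mw lt lu lw [j1 j2]]]]; split; [exact: local_min_turn|exact: local_max_turn|].
  exists w; rewrite /lowest_below !periodic_turn //; split => //.
    by move=> t; rewrite joined_turnl //; apply: lu.
  by split; apply/joined_turnr => //; apply/joined_turnl.
split; last exact: key.
by move=> /(key (- k) (- l)); rewrite !turnK.
Qed.

Lemma H0_pairsE q x y : periodic q T -> continuous q ->
  H0_pairs q (x, y) <-> [/\ angle x, angle y & elder_pair q x y].
Proof.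
move=> qT cq; split.
  move=> [ax ay My [x' [ax' /andP[x'x xy] hc [hx hx']]]]; split => //.
  have [[mx _ _] [mx' _ _] _] := hc (q x) ltac:(by rewrite lexx).
  split => //; exists x'; split => //; first exact/andP.
  - move=> t /(joined_lt_max cq)[c cc jc]; have [[_ _ h] _ _] := hc c cc.
    by apply: h; apply: joined_component.
  - move=> t /(joined_lt_max cq)[c /andP[c1 c2] jc].
    (* An arc starting at [x'] may lie entirely below the birth level of [x], where [hc] gives no
       information; the level is raised to [q x]. *)
    have [|_ [_ _ h] _] := hc (Num.max c (q x)).
      by rewrite le_max lexx orbT gt_max c2.
    apply: h; apply: joined_component; apply: sub_joined jc => s /=.
    by rewrite le_max => ->.
  - by split; apply: component_joined.
move=> [ax ay [mx my [x' [mx' x'xy lx lx' [jx jx']]]]]; split => //.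
exists (wrap x'); split; first exact: angle_wrap.
- by rewrite /wrap periodic_turn.
- move=> c /andP[c1 c2].
  have lm u : local_min q u -> q u <= c -> lowest_below q (q y) u -> lowest_min q c u.
    move=> mu uc lu; split => // t /(component_joined qT) j; apply: lu.
    by apply: sub_joined j => s /= sc; lra.
  move: x'xy => /andP[? ?].
  have lmx : lowest_min q c x by apply: lm.
  split => //; first by apply/lowest_min_wrap => //; apply: lm => //; lra.
  (* If the components were equal, [x'] would lie in that of [x], whose lowest value [q x] exceeds
     [q x']. *)
  rewrite component_wrap => e.
  have : q x <= q x'.
    have [_ _] := lmx; apply; rewrite e; apply: connected_component_refl.
    by exists x' => //=; lra.
  lra.
- by rewrite component_wrap; split; apply: joined_component.
Qed.

(** This form mentions critical points only, both as competitors and as tests along the arc, so it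
    can be transported by a bijection of critical points. *)
Definition lowest_crit q d x : Prop := forall t, crit q t ->
  joined (fun s => crit q s -> q s < d) x t -> q x <= q t.

Definition elder_crit q x y : Prop :=
  [/\ local_min q x, local_max q y &
   exists x', [/\ local_min q x', q x' < q x < q y,
     lowest_crit q (q y) x, lowest_crit q (q y) x' &
     joined (fun s => crit q s -> q s <= q y) x y /\
     joined (fun s => crit q s -> q s <= q y) x' y]].

Section Differentiable.
Variable q : R -> R.
Hypothesis (qT : periodic q T) (dq : forall t, derivable q t 1).

(** The maximum of [q] over an arc with critical ends is attained at a critical point, and [P]
    passes to lower values. *)
Lemma joined_crit (P : R -> Prop) x y : crit q x -> crit q y ->
    (forall s t, q s <= q t -> P t -> P s) ->
  joined P x y <-> joined (fun s => crit q s -> P s) x y.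
Proof.
move=> cx cy dP; split=> -[k h]; exists k; first by move=> t tt _; apply: h.
have cy' : crit q (turn k y) by apply/crit_turn.
have [l|/ltW l] := leP x (turn k y).
  have [m [cm mm hm]] := max_segment dq l cx cy'; have Pm : P m by apply: h => //; left.
  move=> t [tt|/andP[t1 t2]]; apply: dP Pm; apply: hm => //.
  by apply/andP; split; lra.
have [m [cm mm hm]] := max_segment dq l cy' cx; have Pm : P m by apply: h => //; right.
move=> t [/andP[t1 t2]|tt]; apply: dP Pm; apply: hm => //.
by apply/andP; split; lra.
Qed.

Lemma lift_right y x : exists k, x <= turn k y.
Proof. by have [k /andP[h _]] := lift_from x y; exists k. Qed.

(** For the converse, a point [t] lower than [x] need not be critical. Descending from it, with a
    lift of [y] as barrier at height [q y], gives a local minimum lower than [x] and joined to it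
    below [q y]. *)
Lemma lowest_below_crit y x : crit q x ->
  lowest_below q (q y) x <-> lowest_crit q (q y) x.
Proof.
have T0 := @twopi_gt0 R; have cq := derivable_continuous dq; move=> cx; split.
  move=> h t ct j; apply: h; apply/joined_crit => // s u su; exact: le_lt_trans.
move=> h t [k hk]; rewrite leNgt; apply/negP => tx.
have found c : local_min q c -> q c < q x ->
    (forall s, between x c s -> q s < q y) -> False.
  move=> mc cx' hc; have cc := crit_local_min dq mc.
  have : q x <= q c.
    by apply: h => //; exists 0 => s; rewrite turn0 => ss _; apply: hc.
  by lra.
have tx' : q (turn k t) < q x by rewrite periodic_turn.
have [l|/ltW l] := leP x (turn k t).
  have [j j1] := lift_right y (turn k t).
  have [||c [mc xc cx' hc]] := descend_right (d := q y) cq l j1 _ tx'.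
  - by move=> s ss; apply: hk; left.
  - by rewrite periodic_turn.
  apply: (found c) => // s [ss|/andP[s1 s2]]; first exact: hc.
  by apply: hc; apply/andP; split; lra.
have [j /andP[j1 j2]] := lift_from (turn k t - T) y.
have j3 : turn j y <= turn k t by lra.
have [||c [mc xc cx' hc]] := descend_left (d := q y) cq l j3 _ tx'.
- by move=> s ss; apply: hk; right.
- by rewrite periodic_turn.
apply: (found c) => // s [/andP[s1 s2]|ss]; last exact: hc.
by apply: hc; apply/andP; split; lra.
Qed.

Lemma elder_pair_crit x y : elder_pair q x y <-> elder_crit q x y.
Proof.
have jc u : crit q u -> crit q y -> joined (fun s => q s <= q y) u y <->
    joined (fun s => crit q s -> q s <= q y) u y.
  by move=> cu cy; apply: joined_crit => // s t; apply: le_trans.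
split=> -[mx my [x' [mx' xxy lx lx' [j1 j2]]]]; split => //; exists x';
  have cx := crit_local_min dq mx; have cx' := crit_local_min dq mx';
  have cy := crit_local_max dq my.
  by split => //; [exact/lowest_below_crit|exact/lowest_below_crit|split; apply/jc].
by split => //; [exact/lowest_below_crit|exact/lowest_below_crit|split; apply/jc].
Qed.

End Differentiable.
End ElderRule.

(** * Transport of pairs along a correspondence of critical points *)

Section CriticalIsomorphism.
Context {R : realType}.
Implicit Types (q : R -> R) (F : R -> R) (s t u v x y c d : R) (k : int).

Local Notation T := (2 * pi : R).

Definition smooth q : Prop := periodic q T /\ forall t, derivable q t 1.

Lemma smoothN q : smooth q -> smooth (fun t => - q t).
Proof. by move=> [qT dq]; split; [move=> t; rewrite qT | exact: derivable_opp]. Qed.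

Lemma global_max_exists q : smooth q -> exists M, forall t, q t <= q M.
Proof.
move=> [qT dq]; have T0 := @twopi_gt0 R.
have [M _ h] := EVT_max (ltW T0) (continuous_subspaceT (derivable_continuous dq)).
exists M => t; rewrite -(periodic_turn qT (- Num.floor (t / T)) t); apply: h.
by have /andP[t0 t1] := angle_wrap t; rewrite in_itv /=; apply/andP; split => //; apply: ltW.
Qed.

Lemma global_min_exists q : smooth q -> exists m, forall t, q m <= q t.
Proof.
move=> sq; have [m h] := global_max_exists (smoothN sq).
by exists m => t; rewrite -lerN2; apply: h.
Qed.

Lemma global_min_local q m : (forall t, q m <= q t) -> local_min q m.
Proof. by move=> h; apply/local_minP; exists 1 => // t _; apply: h. Qed.

Lemma global_max_local q m : (forall t, q t <= q m) -> local_max q m.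
Proof. by move=> h; apply/local_minN; apply: global_min_local => t; rewrite lerN2. Qed.

(** The order conditions are equations between booleans, so they transfer in both directions;
    [iso_le] also yields injectivity on critical points, and [iso_val] the preservation of ties. *)
Record crit_iso q q' F : Prop := CritIso {
  iso_crit : forall x, crit q x -> crit q' (F x);
  iso_surj : forall y, crit q' y -> exists2 x, crit q x & F x = y;
  iso_le : forall x y, crit q x -> crit q y -> (F x <= F y) = (x <= y);
  iso_turn : forall k x, crit q x -> F (turn k x) = turn k (F x);
  iso_val : forall x y, crit q x -> crit q y -> (q' (F x) < q' (F y)) = (q x < q y);
  iso_min : forall x, crit q x -> local_min q' (F x) <-> local_min q x;
  iso_max : forall x, crit q x -> local_max q' (F x) <-> local_max q x }.

Lemma crit_isoN q q' F : smooth q -> smooth q' -> crit_iso q q' F ->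
  crit_iso (fun t => - q t) (fun t => - q' t) F.
Proof.
move=> [_ dq] [_ dq'] [h1 h2 h3 h4 h5 h6 h7]; split.
- by move=> x /critN => /(_ dq) cx; apply/critN => //; apply: h1.
- by move=> y /critN => /(_ dq') /h2[x cx e]; exists x => //; apply/critN.
- by move=> x y /critN => /(_ dq) cx /critN => /(_ dq) cy; apply: h3.
- by move=> k x /critN => /(_ dq) cx; apply: h4.
- by move=> x y /critN => /(_ dq) cx /critN => /(_ dq) cy; rewrite !ltrN2 h5.
- by move=> x /critN => /(_ dq) cx; split=> /local_minN ?; apply/local_minN; apply/(h7 _ cx).
- by move=> x /critN => /(_ dq) cx; split=> /local_maxN ?; apply/local_maxN; apply/(h6 _ cx).
Qed.

Section Transfer.
Variables (q q' F : R -> R).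
Hypotheses (sq : smooth q) (sq' : smooth q') (iF : crit_iso q q' F).

Lemma iso_valle x y : crit q x -> crit q y -> (q' (F x) <= q' (F y)) = (q x <= q y).
Proof. by move=> cx cy; rewrite !leNgt (iso_val iF). Qed.

Lemma iso_joined (P P' : R -> Prop) x t : crit q x -> crit q t ->
    (forall s, crit q s -> P' (F s) <-> P s) ->
  joined (fun s => crit q' s -> P' s) (F x) (F t) <-> joined (fun s => crit q s -> P s) x t.
Proof.
move=> cx ct PP; have [qT _] := sq.
have btw k s : crit q s -> between (F x) (turn k (F t)) (F s) <-> between x (turn k t) s.
  move=> cs; have ctk : crit q (turn k t) by apply/crit_turn.
  by rewrite /between -(iso_turn iF) // !(iso_le iF).
split=> -[k h]; exists k.
  by move=> s ss cs; apply/PP => //; apply: h; [exact/btw | exact: (iso_crit iF)].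
move=> s' ss /(iso_surj iF)[s cs e]; rewrite -e in ss *.
by apply/PP => //; apply: h => //; apply/btw.
Qed.

Lemma iso_lowest x y : crit q x -> crit q y ->
  lowest_crit q' (q' (F y)) (F x) <-> lowest_crit q (q y) x.
Proof.
move=> cx cy.
have J t : crit q t -> joined (fun s => crit q' s -> q' s < q' (F y)) (F x) (F t) <->
     joined (fun s => crit q s -> q s < q y) x t.
  by move=> ct; apply: iso_joined => // s cs; rewrite (iso_val iF).
split=> h.
  move=> t ct j; rewrite -iso_valle //; apply: h; first exact: (iso_crit iF).
  exact/J.
move=> t' /(iso_surj iF)[t ct <-] j; rewrite iso_valle //; apply: h => //.
exact/J.
Qed.

Lemma iso_elder x y : crit q x -> crit q y ->
  elder_crit q' (F x) (F y) <-> elder_crit q x y.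
Proof.
move=> cx cy; have [qT dq] := sq; have [qT' dq'] := sq'.
have J u : crit q u -> joined (fun s => crit q' s -> q' s <= q' (F y)) (F u) (F y) <->
     joined (fun s => crit q s -> q s <= q y) u y.
  by move=> cu; apply: iso_joined => // s cs; rewrite iso_valle.
split.
  move=> [mx my [x' [mx' xx lx lx' [j1 j2]]]].
  have [u cu e] := iso_surj iF (crit_local_min dq' mx'); rewrite -e in mx' xx lx' j2.
  split; [exact/(iso_min iF)|exact/(iso_max iF)|exists u]; split.
  - exact/(iso_min iF).
  - by move: xx; rewrite !(iso_val iF).
  - exact/iso_lowest.
  - exact/iso_lowest.
  - by split; apply/J.
move=> [mx my [x' [mx' xx lx lx' [j1 j2]]]].
have cx' := crit_local_min dq mx'.
split; [exact/(iso_min iF)|exact/(iso_max iF)|exists (F x')]; split.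
- exact/(iso_min iF).
- by rewrite !(iso_val iF).
- exact/iso_lowest.
- exact/iso_lowest.
- by split; apply/J.
Qed.

Lemma iso_H0 x y : angle x -> angle y -> crit q x -> crit q y ->
  H0_pairs q' (wrap (F x), wrap (F y)) <-> H0_pairs q (x, y).
Proof.
move=> ax ay cx cy; have [qT dq] := sq; have [qT' dq'] := sq'.
rewrite !H0_pairsE //; try exact: derivable_continuous.
have e : elder_pair q' (wrap (F x)) (wrap (F y)) <-> elder_pair q x y.
  by rewrite /wrap elder_pair_turn // !elder_pair_crit // iso_elder.
by split=> -[_ _ h]; split => //; try exact: angle_wrap; apply/e.
Qed.

Lemma iso_global x y : angle x -> angle y -> crit q x -> crit q y ->
  global_pair q' (wrap (F x), wrap (F y)) <-> global_pair q (x, y).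
Proof.
move=> ax ay cx cy; have [qT dq] := sq; have [qT' dq'] := sq'.
rewrite /global_pair /= /wrap !periodic_turn //; split=> -[_ _ h]; split => //.
(* The extreme values are attained at critical points, so a comparison with all [t] reduces to one
   with [m] and [M]. *)
- have [m hm] := global_min_exists sq; have [M hM] := global_max_exists sq.
  have cm := crit_local_min dq (global_min_local hm).
  have cM := crit_local_max dq (global_max_local hM).
  move=> t; apply/andP; split.
    by apply: le_trans (hm t); rewrite -iso_valle //; case/andP: (h (F m)).
  by apply: (le_trans (hM t)); rewrite -iso_valle //; case/andP: (h (F M)).
- exact: angle_wrap.
- exact: angle_wrap.
- have [m' hm] := global_min_exists sq'; have [M' hM] := global_max_exists sq'.
  have [m cm em] := iso_surj iF (crit_local_min dq' (global_min_local hm)).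
  have [M cM eM] := iso_surj iF (crit_local_max dq' (global_max_local hM)).
  move=> t; apply/andP; split.
    by apply: le_trans (hm t); rewrite -em iso_valle //; case/andP: (h m).
  by apply: (le_trans (hM t)); rewrite -eM iso_valle //; case/andP: (h M).
Qed.

End Transfer.

Lemma iso_aug_pairs q q' F x y : smooth q -> smooth q' -> crit_iso q q' F ->
    angle x -> angle y -> crit q x -> crit q y ->
  aug_pairs q' (wrap (F x), wrap (F y)) <-> aug_pairs q (x, y).
Proof.
move=> sq sq' iF ax ay cx cy; have [_ dq] := sq.
have h1 := iso_H0 sq sq' iF ax ay cx cy.
have h2 := iso_H0 (smoothN sq) (smoothN sq') (crit_isoN sq sq' iF) ax ay.
have {}h2 := h2 ((critN _ dq).2 cx) ((critN _ dq).2 cy).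
have h3 := iso_global sq sq' iF ax ay cx cy.
rewrite /aug_pairs; split.
  by move=> [[/h1|/h2]|/h3]; [left; left|left; right|right].
by move=> [[/h1|/h2]|/h3]; [left; left|left; right|right].
Qed.

Lemma aug_pairs_crit q x y : smooth q -> aug_pairs q (x, y) ->
  [/\ angle x, angle y, crit q x & crit q y].
Proof.
move=> sq; have [qT dq] := sq; have [nT dn] := smoothN sq; move=> [[|]|].
- move=> /H0_pairsE => /(_ qT (derivable_continuous dq))[ax ay [mx my _]].
  by split => //; [exact: crit_local_min | exact: crit_local_max].
- move=> /H0_pairsE => /(_ nT (derivable_continuous dn))[ax ay [mx my _]].
  by split => //; apply/critN => //; [exact: crit_local_min | exact: crit_local_max].
- move=> [ax ay h]; split => //.
    by apply: crit_local_min => //; apply: global_min_local => t; case/andP: (h t).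
  by apply: crit_local_max => //; apply: global_max_local => t; case/andP: (h t).
Qed.

End CriticalIsomorphism.

(** * Perturbation of nondegenerate critical points *)

Section Perturbation.
Context {R : realType}.
Implicit Types (q g : R -> R) (F : R -> R) (s t u v x y c d m w r e : R) (k : int).

Local Notation T := (2 * pi : R).
Local Notation "q ^``" := (q^`()%classic^`()%classic) (at level 2, format "q ^``").

Definition twice_smooth q : Prop := smooth q /\ forall t, derivable q^`()%classic t 1.

Lemma mean_value g s t : (forall u, derivable g u 1) -> s <= t ->
  exists c, s <= c <= t /\ g t - g s = g^`()%classic c * (t - s).
Proof.
move=> dg st.
have [||c] := @MVT_segment R g g^`()%classic s t st.
- by move=> u _; rewrite derive1E; apply: derivableP.
- by apply: continuous_subspaceT; apply: derivable_continuous.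
by rewrite in_itv /= => cc e; exists c.
Qed.

(** A slope of at least [l] changes [g] by at least [l * r] on each side of [t], which suffices for
    a change of sign. Applied to a first derivative, it turns an almost critical point into a nearby
    critical one. *)
Lemma zero_near_incr g t r (l : R) : (forall u, derivable g u 1) -> 0 <= r ->
    (forall s, `|s - t| <= r -> l <= g^`()%classic s) -> `|g t| <= l * r ->
  exists2 c, `|c - t| <= r & g c = 0.
Proof.
move=> dg r0 hl; rewrite ler_norml => /andP[g1 g2].
have [|c1 [/andP[c11 c12] e1]] := @mean_value g t (t + r) dg; first by lra.
have [|c2 [/andP[c21 c22] e2]] := @mean_value g (t - r) t dg; first by lra.
have l1 : l <= g^`()%classic c1 by apply: hl; rewrite ler_norml; apply/andP; split; lra.
have l2 : l <= g^`()%classic c2 by apply: hl; rewrite ler_norml; apply/andP; split; lra.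
have m1 : l * r <= g^`()%classic c1 * r by apply: ler_wpM2r.
have m2 : l * r <= g^`()%classic c2 * r by apply: ler_wpM2r.
have e1' : t + r - t = r by ring.
have e2' : t - (t - r) = r by ring.
rewrite e1' in e1; rewrite e2' in e2.
have tr : t - r <= t + r by lra.
have h0 : Num.min (g (t - r)) (g (t + r)) <= 0 <= Num.max (g (t - r)) (g (t + r)).
  by rewrite ge_min le_max; apply/andP; split; apply/orP; [left|right]; lra.
have [c] := IVT tr (continuous_subspaceT (derivable_continuous dg)) h0.
rewrite in_itv /= => /andP[c3 c4] gc; exists c => //.
by rewrite ler_norml; apply/andP; split; lra.
Qed.

Lemma strict_min_of_slopes (g g1 g2 : R -> R) c d :
    (forall s t, s <= t -> exists u, s <= u <= t /\ g t - g s = g1 u * (t - s)) ->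
    (forall s t, s <= t -> exists u, s <= u <= t /\ g1 t - g1 s = g2 u * (t - s)) ->
    g1 c = 0 -> (forall s, `|s - c| <= d -> 0 < g2 s) ->
  forall t, t != c -> `|t - c| <= d -> g c < g t.
Proof.
move=> mv mv1 cc hs.
have right t : c < t -> t - c <= d -> 0 < g1 t.
  move=> ct tcd; have [u [/andP[u1 u2]]] := mv1 c t (ltW ct).
  rewrite cc subr0 => ->; apply: mulr_gt0; last by lra.
  by apply: hs; rewrite ler_norml; apply/andP; split; lra.
have left t : t < c -> c - t <= d -> g1 t < 0.
  move=> ct tcd; have [u [/andP[u1 u2]]] := mv1 t c (ltW ct).
  rewrite cc sub0r => e; rewrite -oppr_gt0 e; apply: mulr_gt0; last by lra.
  by apply: hs; rewrite ler_norml; apply/andP; split; lra.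
move=> t tc; rewrite ler_norml => /andP[t1 t2].
have [lt|gt|e] := ltgtP c t; last by rewrite e eqxx in tc.
  (* The mean value point of [c, t] could be [c] itself, where the slope vanishes. Cutting at the
     midpoint gives a weak inequality on the half next to [c] and a strict one on the other. *)
  have [p [/andP[p1 p2] pe]] := mv c ((c + t) / 2) ltac:(lra).
  have [r [/andP[r1 r2] re]] := mv ((c + t) / 2) t ltac:(lra).
  have p0 : 0 <= g1 p.
    have [->|pc] := eqVneq p c; first by rewrite cc.
    by apply/ltW/right; rewrite ?lt_neqAle 1?eq_sym ?pc //; lra.
  have r0 : 0 < g1 r by apply: right; lra.
  have : 0 <= g1 p * ((c + t) / 2 - c) by apply: mulr_ge0 => //; lra.
  have : 0 < g1 r * (t - (c + t) / 2) by apply: mulr_gt0 => //; lra.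
  by lra.
have [p [/andP[p1 p2] pe]] := mv ((c + t) / 2) c ltac:(lra).
have [r [/andP[r1 r2] re]] := mv t ((c + t) / 2) ltac:(lra).
have p0 : g1 p <= 0.
  have [->|pc] := eqVneq p c; first by rewrite cc.
  by apply/ltW/left; rewrite ?lt_neqAle ?pc //; lra.
have r0 : g1 r < 0 by apply: left; lra.
have : 0 <= - g1 p * (c - (c + t) / 2) by apply: mulr_ge0; lra.
have : 0 < - g1 r * ((c + t) / 2 - t) by apply: mulr_gt0; lra.
by lra.
Qed.

(** A quantitative Morse condition: the constants can be shared by [q] and all functions close to
    it, so the radii found below are uniform over the perturbations. *)
Definition regular m w d q : Prop :=
  [/\ twice_smooth q, forall t, m <= `|q^`()%classic t| + `|q^`` t| &
      forall s t, `|s - t| <= d -> `|q^`` s - q^`` t| <= w].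

Section Regular.
Variables (m w d : R) (q : R -> R).
Hypotheses (m0 : 0 < m) (d0 : 0 < d) (wm : w <= m / 4) (rq : regular m w d q).

Lemma regular_crit_curv c : crit q c -> m <= `|q^`` c|.
Proof. by case: rq => _ /(_ c) h _; rewrite /crit => e; move: h; rewrite e normr0 add0r. Qed.

Lemma regular_near_crit t r : 0 <= r <= d -> `|q^`()%classic t| <= m / 4 ->
  `|q^`()%classic t| <= m / 2 * r -> exists2 c, `|c - t| <= r & crit q c.
Proof.
have wm' := wm; case: rq => -[_ dq1] hm hw /andP[r0 rd] t1 t2.
(* Within distance [d] of [t] the curvature loses at most [w <= m / 4], which leaves the slope
   [m / 2] for [zero_near_incr]. *)
have : 3 / 4 * m <= `|q^`` t| by have := hm t; lra.
rewrite ler_normr => /orP[] h.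
  apply: (@zero_near_incr _ t r (m / 2) dq1 r0) t2 => s sr.
  have := hw s t (le_trans sr rd); rewrite ler_norml => /andP[h1 h2].
  by move: (q^`` s) (q^`` t) h h1 h2 => A B h h1 h2; lra.
have [||c c1 c2] := @zero_near_incr (fun u => - q^`()%classic u) t r (m / 2) (derivable_opp dq1) r0.
- move=> s sr; have := hw s t (le_trans sr rd); rewrite ler_norml => /andP[h1 h2].
  rewrite (@derive1_opp _ _ s dq1).
  by move: (q^`` s) (q^`` t) h h1 h2 => A B h h1 h2; lra.
- by rewrite normrN.
by exists c => //; apply/eqP; rewrite -oppr_eq0; apply/eqP.
Qed.

(** Between two critical points the curvature vanishes somewhere, but near a critical point it stays
    away from 0. *)
Lemma regular_crit_unique x y : crit q x -> crit q y -> `|x - y| <= d -> x = y.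
Proof.
wlog xy : x y / x <= y.
  move=> H cx cy; have [xy|/ltW yx] := leP x y; first exact: H.
  by rewrite distrC => h; apply/esym; apply: H.
have wm' := wm; have m0' := m0.
move=> cx cy; rewrite distrC => xyd; case: rq => -[_ dq1] _ hw.
have [c [/andP[c1 c2]]] := mean_value dq1 xy.
rewrite cx cy subrr => /esym/eqP; rewrite mulf_eq0 => /orP[/eqP qc|]; last first.
  by rewrite subr_eq0 => /eqP.
have := regular_crit_curv cx; have := hw x c.
rewrite qc subr0 => h; have : `|q^`` x| <= w.
  by apply: h; move: xyd; rewrite !ler_norml => /andP[? ?]; apply/andP; split; lra.
by move: (`|q^`` x|) => A h1 h2; lra.
Qed.

Lemma second_derivative_test g c : (forall t, derivable g t 1) ->
    (forall t, derivable g^`()%classic t 1) -> crit g c ->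
    (forall s, `|s - c| <= d -> 0 < g^`` s) ->
  forall t, t != c -> `|t - c| <= d -> g c < g t.
Proof.
move=> dg dg1.
exact: (strict_min_of_slopes (fun s t => @mean_value g s t dg) (fun s t => @mean_value _ s t dg1)).
Qed.

Lemma regular_curv_pos c s : crit q c -> 0 < q^`` c -> `|s - c| <= d -> 0 < q^`` s.
Proof.
move=> cc qc sc; have wm' := wm; have m0' := m0; have := regular_crit_curv cc.
have hw : `|q^`` s - q^`` c| <= w by case: rq => _ _; apply.
rewrite (gtr0_norm qc) => h3.
move: hw; rewrite ler_norml => /andP[h1 h2].
move: (q^`` s) (q^`` c) h1 h2 h3 => A B h1 h2 h3.
by lra.
Qed.

Lemma regular_curv_min c : crit q c -> 0 < q^`` c -> local_min q c.
Proof.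
move=> cc qc; apply/local_minP; exists d => // t /ltW tc.
have [->//|tnc] := eqVneq t c; case: rq => -[[_ dq] dq1] _ _.
apply/ltW/(second_derivative_test dq dq1 cc _ tnc tc) => s.
exact: regular_curv_pos.
Qed.

End Regular.

Lemma derive1n2_opp q t : twice_smooth q -> (fun u => - q u)^`` t = - q^`` t.
Proof.
move=> [[_ dq] dq1]; rewrite -(derive1_opp t dq1).
by congr (_^`()%classic t); apply/funext => u; apply: derive1_opp.
Qed.

Lemma twice_smoothN q : twice_smooth q -> twice_smooth (fun t => - q t).
Proof.
move=> [sq dq1]; split; first exact: smoothN.
move=> t; have -> : (fun t => - q t)^`()%classic = fun t => - q^`()%classic t.
  by apply/funext => u; apply: derive1_opp; case: sq.
exact: derivable_opp.
Qed.

Lemma regularN m w d q : regular m w d q -> regular m w d (fun t => - q t).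
Proof.
move=> [sq hm hw]; split; first exact: twice_smoothN.
  by move=> t; rewrite derive1n2_opp // derive1_opp ?normrN; [apply: hm | case: sq => -[]].
by move=> s t st; rewrite !derive1n2_opp // -opprD normrN; apply: hw.
Qed.

Lemma regular_min m w d q c : 0 < m -> 0 < d -> w <= m / 4 -> regular m w d q ->
  crit q c -> local_min q c <-> 0 < q^`` c.
Proof.
move=> m0 d0 wm rq cc; split; last exact: (regular_curv_min m0 d0 wm rq).
move=> /local_minP[e e0 h]; rewrite ltNge; apply/negP => qc.
have {}qc : 0 < (fun t => - q t)^`` c.
  have [sq _ _] := rq; rewrite derive1n2_opp // oppr_gt0 lt_neqAle qc andbT.
  by apply/eqP => q0; have := regular_crit_curv rq cc; rewrite q0 normr0 leNgt m0.
have [[[_ dq] dq1] _ _] := regularN rq.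
have cc' : crit (fun t => - q t) c by apply/critN => //; case: rq => -[[]].
(* The test point [c + f] must lie in the open window of radius [e] where [c] is minimal and in the
   closed one of radius [d] where the curvature keeps its sign. *)
have [f f0 [fe fd]] : exists2 f, 0 < f & f < e /\ f <= d.
  exists (Num.min (e / 2) d); first by rewrite lt_min d0 divr_gt0.
  by rewrite gt_min ge_min lexx orbT; split=> //; apply/orP; left; lra.
have fN : `|c + f - c| = f by rewrite addrAC subrr add0r gtr0_norm.
have := second_derivative_test dq dq1 cc' (fun s => regular_curv_pos m0 wm (regularN rq) cc' qc).
move=> /(_ (c + f)).
rewrite fN ltrN2 -subr_eq0 addrAC subrr add0r gt_eqF // => /(_ isT fd).
by rewrite ltNge h // fN.
Qed.

Lemma regular_max m w d q c : 0 < m -> 0 < d -> w <= m / 4 -> regular m w d q ->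
  crit q c -> local_max q c <-> q^`` c < 0.
Proof.
move=> m0 d0 wm rq cc; have [sq _ _] := rq.
have cc' : crit (fun t => - q t) c by apply/critN => //; case: rq => -[[]].
rewrite -oppr_gt0 -derive1n2_opp // -(regular_min m0 d0 wm (regularN rq) cc').
by rewrite local_minN.
Qed.

End Perturbation.

(** * Matching the critical points of two close functions *)

Section ClosePerturbation.
Context {R : realType}.
Implicit Types (q g : R -> R) (F : R -> R) (s t u v x y c d m w r e : R) (k : int).

Local Notation T := (2 * pi : R).
Local Notation "q ^``" := (q^`()%classic^`()%classic) (at level 2, format "q ^``").

Section Close.
Variables (m w d e r v n : R) (q q' : R -> R).
Hypotheses (m0 : 0 < m) (r0 : 0 < r) (rd : 2 * r < d) (wm : w <= m / 4) (em : e <= m / 4)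
  (er : e <= m / 2 * r) (rq : regular m w d q) (rq' : regular m w d q').
Hypotheses (close1 : forall t, `|q'^`()%classic t - q^`()%classic t| <= e)
  (close2 : forall t, `|q'^`` t - q^`` t| <= e)
  (close0 : forall x t, `|t - x| <= r -> `|q' t - q x| <= v).
Hypotheses (sep : forall x y, crit q x -> crit q y -> q x = q y -> exists k, y = turn k x)
  (gap : forall x y, crit q x -> crit q y -> q x < q y -> q x + n <= q y) (vn : 2 * v < n).

(** The bounds on [e] make a critical point of either function almost critical for the other, hence
    within [r] of a true one. Critical points of [q] are more than [d] apart, so [2 * r < d] gives
    uniqueness and order; [2 * v < n] does the same for the values, ties occurring only between
    translates. The curvature changes by at most [e + w < m] but has size at least [m] at both
    points, so its sign is kept. *)
Lemma close_crit_iso :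
  exists2 F, crit_iso q q' F & forall x, crit q x -> `|F x - x| <= r.
Proof.
have m0' := m0; have r0' := r0; have rd' := rd; have wm' := wm; have vn' := vn; have em' := em.
have d0 : 0 < d by lra.
have rrd : 0 <= r <= d by apply/andP; split; lra.
have [[[qT dq] dq1] _ _] := rq; have [[[qT' dq'] dq1'] _ _] := rq'.
have to x : crit q x -> exists2 y, `|y - x| <= r & crit q' y.
  rewrite /crit => cx; have := close1 x; rewrite cx subr0 => h.
  by apply: (regular_near_crit wm rq') => //; apply: le_trans h _.
have from y : crit q' y -> exists2 x, `|x - y| <= r & crit q x.
  rewrite /crit => cy; have := close1 y; rewrite cy sub0r normrN => h.
  by apply: (regular_near_crit wm rq) => //; apply: le_trans h _.
have /choice[F hF] : forall x, exists y, crit q x -> `|y - x| <= r /\ crit q' y.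
  move=> x; have [cx|nc] := pselect (crit q x); last by exists 0.
  by have [y h1 h2] := to x cx; exists y.
have Fr x : crit q x -> `|F x - x| <= r by move=> /hF[].
have Fc x : crit q x -> crit q' (F x) by move=> /hF[].
have Fu x y : crit q x -> crit q' y -> `|y - x| <= r -> F x = y.
  move=> cx cy yx; apply: (regular_crit_unique m0 wm rq') => //; first exact: Fc.
  have := Fr x cx; move: yx; rewrite !ler_norml => /andP[? ?] /andP[? ?].
  by apply/andP; split; lra.
have Flt x y : crit q x -> crit q y -> x < y -> F x < F y.
  move=> cx cy xy; have : d < y - x.
    rewrite ltNge; apply/negP => h.
    have xyE : x = y.
      apply: (regular_crit_unique m0 wm rq) => //.
      by rewrite distrC gtr0_norm ?subr_gt0.
    by rewrite xyE ltxx in xy.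
  have := Fr x cx; have := Fr y cy; rewrite !ler_norml => /andP[? ?] /andP[? ?] ?; lra.
(* [F] comes from a choice that ignores translations; equivariance is recovered from uniqueness. *)
have Ft k x : crit q x -> F (turn k x) = turn k (F x).
  move=> cx; apply: Fu; [exact/crit_turn | by apply/crit_turn => //; apply: Fc |].
  by have := Fr x cx; rewrite /turn; congr (`|_| <= _); ring.
have Fv x y : crit q x -> crit q y -> q x < q y -> q' (F x) < q' (F y).
  move=> cx cy xy; have := gap cx cy xy.
  have := close0 (Fr x cx); have := close0 (Fr y cy).
  by rewrite !ler_norml => /andP[? ?] /andP[? ?] ?; lra.
have curv x : crit q x -> `|q'^`` (F x) - q^`` x| < m.
  have tri (A B C : R) : `|A - B| <= e -> `|B - C| <= w -> `|A - C| < m.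
    by rewrite !ler_norml ltr_norml => /andP[? ?] /andP[? ?]; apply/andP; split; lra.
  move=> cx; apply: tri (close2 (F x)) _; case: rq => _ _; apply.
  by apply: le_trans (Fr x cx) _; lra.
have curv1 x : crit q x -> m <= `|q^`` x| by apply: (regular_crit_curv rq).
have curv2 x : crit q x -> m <= `|q'^`` (F x)| by move=> /Fc; apply: (regular_crit_curv rq').
have same_sign (A B : R) : `|B - A| < m -> m <= `|A| -> m <= `|B| ->
    ((0 < B) <-> (0 < A)) /\ ((B < 0) <-> (A < 0)).
  rewrite ltr_norml !ler_normr => /andP[? ?] /orP[] ? /orP[] ?.
  - by split; split=> ?; lra.
  - by split; split=> ?; lra.
  - by split; split=> ?; lra.
  - by split; split=> ?; lra.
exists F; last exact: Fr.
split; [exact: Fc | | | by move=> k x; exact: Ft | | | ].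
- move=> y cy; have [x xy cx] := from y cy; exists x => //.
  by apply: Fu => //; rewrite distrC.
- move=> x y cx cy; have [xy|yx|->] := ltgtP x y; last by rewrite !lexx.
    by apply/ltW; apply: Flt.
  by apply/negbTE; rewrite -ltNge; apply: Flt.
- move=> x y cx cy; have [xy|yx|xy] := ltgtP (q x) (q y); first exact: Fv.
    by apply/negbTE; rewrite -leNgt ltW //; apply: Fv.
  by have [k ->] := sep cx cy xy; rewrite Ft // periodic_turn // ltxx.
- move=> x cx; rewrite (regular_min m0 d0 wm rq' (Fc x cx)) (regular_min m0 d0 wm rq cx).
  exact: (same_sign _ _ (curv x cx) (curv1 x cx) (curv2 x cx)).1.
- move=> x cx; rewrite (regular_max m0 d0 wm rq' (Fc x cx)) (regular_max m0 d0 wm rq cx).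
  exact: (same_sign _ _ (curv x cx) (curv1 x cx) (curv2 x cx)).2.
Qed.

End Close.
End ClosePerturbation.

(** * Hoelder bounds and the derivatives controlled by the norm *)

Section HolderSpace.
Context {R : realType}.
Implicit Types (q g : R -> R) (F : R -> R) (a s t u v x y c d m w r e : R) (k : int).

Local Notation T := (2 * pi : R).
Local Notation "q ^``" := (q^`()%classic^`()%classic) (at level 2, format "q ^``").

Lemma inX_smooth a q : inX a q -> twice_smooth q.
Proof. by case. Qed.

Lemma holder_bound a q : inX a q -> exists2 H, 0 <= H & forall s t,
  0 <= s <= T -> 0 <= t <= T -> `|q^`` s - q^`` t| <= H * `|s - t| `^ a.
Proof.
move=> [_ _ _ [H hH]]; exists (Num.max H 0); first by rewrite le_max lexx orbT.
move=> s t s1 t1; have [->|st] := eqVneq s t.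
  by rewrite !subrr normr0 mulr_ge0 ?powR_ge0 // le_max lexx orbT.
have p0 : 0 < `|s - t| `^ a by rewrite powR_gt0 // normr_gt0 subr_eq0.
rewrite -ler_pdivrMr // le_max; apply/orP; left; apply: hH.
by exists s, t.
Qed.

(** After translation, a pair at distance at most [T] lies in one period or straddles its end. In
    the second case the path through the common value [phi T = phi 0] has two pieces, whence the
    factor 2. *)
Lemma holder_bound_periodic (phi : R -> R) a (H : R) : 0 < a -> 0 <= H -> periodic phi T ->
    (forall s t, 0 <= s <= T -> 0 <= t <= T -> `|phi s - phi t| <= H * `|s - t| `^ a) ->
  forall s t, `|s - t| <= T -> `|phi s - phi t| <= 2 * H * `|s - t| `^ a.
Proof.
move=> a0 H0 pT hH; have T0 := @twopi_gt0 R; have T0' := ltW T0.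
have mono x y : 0 <= x -> x <= y -> H * x `^ a <= H * y `^ a.
  move=> x0 xy; apply: ler_wpM2l => //; apply: ge0_ler_powR => //.
  - exact: ltW.
  - by rewrite nnegrE (le_trans x0).
have pos x : 0 <= H * x `^ a by rewrite mulr_ge0 ?powR_ge0.
suff main s t : s <= t -> t - s <= T -> `|phi s - phi t| <= 2 * H * (t - s) `^ a.
  move=> s t; have [st|/ltW ts] := leP s t.
    have -> : `|s - t| = t - s by rewrite distrC ger0_norm ?subr_ge0.
    exact: main.
  have -> : `|s - t| = s - t by rewrite ger0_norm ?subr_ge0.
  rewrite distrC; exact: main.
move=> st stT; have [k kE] := wrapE s; have /andP[w0 wT] := angle_wrap s.
rewrite -(periodic_turn pT k s) -(periodic_turn pT k t) -kE.
have -> : t - s = turn k t - wrap s by rewrite kE /turn; ring.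
have : wrap s <= turn k t by rewrite kE /turn lerD2r.
have : turn k t <= wrap s + T by rewrite kE /turn; lra.
move: (wrap s) (turn k t) w0 wT => x y x0 xT yxT xy; rewrite -mulrA.
have [yT|Ty] := leP y T.
  have h : `|phi x - phi y| <= H * `|x - y| `^ a by apply: hH; apply/andP; split; lra.
  apply: le_trans h _; rewrite distrC ger0_norm ?subr_ge0 //.
  by have := pos (y - x); move: (H * _ `^ a) => z; lra.
have h1 : `|phi x - phi T| <= H * (y - x) `^ a.
  apply: le_trans (hH _ _ _ _) _; [by apply/andP; split; lra|by apply/andP; split; lra|].
  by apply: mono => //; rewrite ler_norml; apply/andP; split; lra.
have h2 : `|phi 0 - phi (y - T)| <= H * (y - x) `^ a.
  apply: le_trans (hH _ _ _ _) _; [by apply/andP; split; lra|by apply/andP; split; lra|].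
  by apply: mono => //; rewrite ler_norml; apply/andP; split; lra.
have e1 : phi T = phi 0 by rewrite -(pT 0) add0r.
have e2 : phi (y - T) = phi y by have := pT (y - T); rewrite subrK.
rewrite e1 in h1; rewrite e2 in h2.
apply: le_trans (ler_distD (phi 0) _ _) _.
by move: h1 h2; move: (H * _) `|phi x - _| `|_ - phi y| => A B C; lra.
Qed.

Lemma holder_bound_circle a q : 0 < a -> inX a q -> exists2 H, 0 <= H & forall s t,
  `|s - t| <= T -> `|q^`` s - q^`` t| <= H * `|s - t| `^ a.
Proof.
move=> a0 qX; have [[qT _] _] := inX_smooth qX; have [H H0 hH] := holder_bound qX.
exists (2 * H); first by rewrite mulr_ge0.
exact: holder_bound_periodic a0 H0 (periodic_derive1 (periodic_derive1 qT)) hH.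
Qed.

Lemma modulus a q w : 0 < a -> inX a q -> 0 < w -> exists2 d, 0 < d & forall s t,
  `|s - t| <= d -> `|q^`` s - q^`` t| <= w.
Proof.
move=> a0 qX w0; have [H H0 hH] := holder_bound_circle a0 qX.
have T0 := @twopi_gt0 R.
have b0 : 0 < w / (H + 1) by apply: divr_gt0 => //; lra.
have c0 : 0 < (w / (H + 1)) `^ a^-1 by apply: powR_gt0.
(* Solves [H * d ^ a <= w] for [d], with [H + 1] to cover [H = 0]; the Hoelder bound is available up
   to distance [T]. *)
exists (Num.min T ((w / (H + 1)) `^ a^-1)); first by rewrite lt_min T0.
move=> s t; rewrite le_min => /andP[h1 h2]; apply: le_trans (hH _ _ h1) _.
have : `|s - t| `^ a <= w / (H + 1).
  have -> : w / (H + 1) = ((w / (H + 1)) `^ a^-1) `^ a.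
    by rewrite -powRrM mulVf ?gt_eqF // powRr1 // ltW.
  by apply: ge0_ler_powR; rewrite ?nnegrE ?normr_ge0 // ltW.
move=> h3; apply: le_trans (ler_wpM2l H0 h3) _.
by rewrite mulrA ler_pdivrMr; nra.
Qed.

Lemma continuous_second a q : 0 < a -> inX a q -> continuous q^``.
Proof.
move=> a0 qX t; apply/cvgrPdist_le => /= e e0.
have [d d0 h] := modulus a0 qX e0.
apply/nbhs_ballP; exists d => //= s; rewrite /ball /= => sd.
by apply: h; apply: ltW.
Qed.

(** A set without supremum has [sup] equal to 0 by default, so the Hoelder term of the norm is
    nonnegative in every case. *)
Lemma sup_ge0 (A : set R) : (forall x, A x -> 0 <= x) -> 0 <= sup A.
Proof.
move=> A0; have [[[x Ax] ub]|ns] := pselect (has_sup A); last by rewrite sup_out.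
by apply: le_trans (A0 _ Ax) _; apply: ub_le_sup.
Qed.

Lemma continuous_normr g : continuous g -> continuous (fun t => `|g t|).
Proof. by move=> cg t; apply: continuous_comp; [exact: cg | exact: norm_continuous]. Qed.

Lemma sup_norm_ge g : continuous g -> periodic g T -> forall t, `|g t| <= sup_norm g.
Proof.
move=> cg gT t; have T0 := @twopi_gt0 R.
rewrite -(periodic_turn gT (- Num.floor (t / T)) t); have /andP[t0 t1] := angle_wrap t.
apply: ub_le_sup; last by exists (wrap t) => //=; rewrite in_itv /= t0 ltW.
have [c _ h] := EVT_max (ltW T0) (continuous_subspaceT (continuous_normr cg)).
by exists `|g c| => _ [u /= uu <-]; apply: h.
Qed.

Lemma sup_norm_ge0 g : 0 <= sup_norm g.
Proof. by apply: sup_ge0 => _ [t _ <-]. Qed.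

Lemma normX_ge a g : twice_smooth g -> continuous g^`` ->
  forall t, [/\ `|g t| <= normX a g, `|g^`()%classic t| <= normX a g & `|g^`` t| <= normX a g].
Proof.
move=> [[gT dg] dg1] c2 t.
have g1T := periodic_derive1 gT; have g2T := periodic_derive1 g1T.
have b0 := sup_norm_ge (derivable_continuous dg) gT t.
have b1 := sup_norm_ge (derivable_continuous dg1) g1T t.
have b2 := sup_norm_ge c2 g2T t.
have h : 0 <= sup (holder_quotients a g).
  by apply: sup_ge0 => _ [s [u [_ _ _ ->]]]; rewrite divr_ge0 ?powR_ge0.
rewrite /normX -[derive1n 2 g]/(g^``).
have := sup_norm_ge0 g; have := sup_norm_ge0 g^`()%classic; have := sup_norm_ge0 g^``.
move: (sup_norm g) (sup_norm g^`()%classic) (sup_norm g^``) (sup _) b0 b1 b2 h.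
move: `|g t| `|g^`()%classic t| `|g^`` t| => A0 A1 A2 B0 B1 B2 S b0 b1 b2 h h2 h1 h0.
by split; lra.
Qed.

End HolderSpace.

(** * Structural stability of admissible functions *)

Section AdmissiblePerturbation.
Context {R : realType}.
Implicit Types (q g : R -> R) (F : R -> R) (a s t u v x y c d m w r e : R) (k : int).

Local Notation T := (2 * pi : R).
Local Notation "q ^``" := (q^`()%classic^`()%classic) (at level 2, format "q ^``").

Lemma lipschitz_derive1 g (l : R) : (forall t, derivable g t 1) ->
  (forall t, `|g^`()%classic t| <= l) -> forall s t, `|g s - g t| <= l * `|s - t|.
Proof.
move=> dg hl s t; wlog ts : s t / t <= s.
  move=> H; have [ts|/ltW st] := leP t s; first exact: H.
  by rewrite distrC [X in _ <= _ * X]distrC; apply: H.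
have [c [_ ->]] := mean_value dg ts.
by rewrite normrM; apply: ler_wpM2r (hl c).
Qed.

Lemma continuous_normrD g g' : continuous g -> continuous g' ->
  continuous (fun t => `|g t| + `|g' t|).
Proof.
move=> cg cg' t; apply: cvgD; first exact: (continuous_normr cg).
exact: (continuous_normr cg').
Qed.

Lemma nondegenerate_bound a q : 0 < a -> inX a q -> morse q ->
  exists2 m, 0 < m & forall t, m <= `|q^`()%classic t| + `|q^`` t|.
Proof.
move=> a0 qX mq; have T0 := @twopi_gt0 R.
have [[qT dq] dq1] := inX_smooth qX; have c2 := continuous_second a0 qX.
have p1 := periodic_derive1 qT; have p2 := periodic_derive1 p1.
pose h t := `|q^`()%classic t| + `|q^`` t|.
have ch : continuous h.
  exact: continuous_normrD (derivable_continuous dq1) c2.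
have [c _ hc] := EVT_min (ltW T0) (continuous_subspaceT ch).
exists (h c).
  rewrite /h; have [e|n1] := eqVneq (q^`()%classic c) 0.
    by rewrite ltr_wpDl // normr_gt0; apply: (mq c e).
  by rewrite ltr_pwDl // normr_gt0.
move=> t; rewrite -(periodic_turn p1 (- Num.floor (t / T)) t) -(periodic_turn p2 (- Num.floor (t / T)) t).
have /andP[t0 t1] := angle_wrap t.
by apply: (hc (wrap t)); rewrite in_itv /= t0 ltW.
Qed.

(** Each cell of length [d] contains at most one point of [A], and finitely many cells cover the
    circle. *)
Lemma finite_angles (A : set R) d : 0 < d -> A `<=` (@angle R) ->
    (forall x y, A x -> A y -> `|x - y| <= d -> x = y) -> finite_set A.
Proof.
move=> d0 hA sep; have T0 := @twopi_gt0 R.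
pose f x := Num.truncn (x / d).
have xd0 x : A x -> 0 <= x / d by move=> /hA/andP[x0 _]; rewrite divr_ge0 // ltW.
have fi : {in A &, injective f}.
  move=> x y /set_mem Ax /set_mem Ay exy; apply: sep => //.
  have /andP[x1 x2] := truncn_itv (xd0 x Ax); have /andP[y1 y2] := truncn_itv (xd0 y Ay).
  move: x1 x2 y1 y2; rewrite -/(f x) -/(f y) exy -[(f y).+1%:R]natr1.
  rewrite !ler_pdivlMr // !ltr_pdivrMr // => x1 x2 y1 y2.
  by rewrite ler_norml; apply/andP; split; lra.
rewrite -(eq_finite_set (inj_card_eq fi)).
apply: (@sub_finite_set _ _ `I_(Num.truncn (T / d)).+1); last exact: finite_II.
move=> _ [x Ax <-] /=; rewrite ltnS; apply: le_truncn.
by rewrite ler_pM2r ?invr_gt0 //; case/andP: (hA _ Ax) => _ /ltW.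
Qed.

Lemma finite_positive_bound (I : choiceType) (A : set I) (h : I -> R) : finite_set A ->
  (forall i, A i -> 0 < h i) -> exists2 n, 0 < n & forall i, A i -> n <= h i.
Proof.
move=> /finite_seqP[s ->]; elim: s => [|x s IH] h0; first by exists 1.
have [y ys|n n0 hn] := IH; first by apply: h0; rewrite /= in_cons ys orbT.
exists (Num.min n (h x)); first by rewrite lt_min n0 h0 //= mem_head.
move=> y /=; rewrite in_cons => /orP[/eqP ->|ys]; first by rewrite ge_min lexx orbT.
by rewrite ge_min hn.
Qed.

Lemma regular_finite_crit m w d q : 0 < m -> 0 < d -> w <= m / 4 -> regular m w d q ->
  finite_set [set x | angle x /\ crit q x].
Proof.
move=> m0 d0 wm rq; apply: (@finite_angles _ d) => //; first by move=> x [].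
move=> x y [_ cx] [_ cy]; exact: (regular_crit_unique m0 wm rq).
Qed.

Lemma crit_value_gap q : smooth q -> finite_set [set x | angle x /\ crit q x] ->
  exists2 n, 0 < n & forall x y, crit q x -> crit q y -> q x < q y -> q x + n <= q y.
Proof.
move=> [qT dq] fin; set A := [set x | _] in fin.
(* Ties receive the dummy value 1, so that [h] is positive on every pair. *)
pose h (p : R * R) := if q p.1 == q p.2 then 1 else `|q p.1 - q p.2|.
have [p _|n n0 hn] := @finite_positive_bound _ (A `*` A) h (finite_setX fin fin).
  by rewrite /h; case: eqP => // /eqP ne; rewrite normr_gt0 subr_eq0.
exists n => // x y cx cy xy.
have Aw u : crit q u -> A (wrap u).
  by move=> cu; split; [exact: angle_wrap | apply/crit_turn].
have := hn (wrap x, wrap y) (conj (Aw _ cx) (Aw _ cy)).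
rewrite /h /= /wrap !periodic_turn // (lt_eqF xy) distrC gtr0_norm ?subr_gt0 //.
by lra.
Qed.

Lemma derive1_sub g g' : (forall t, derivable g t 1) -> (forall t, derivable g' t 1) ->
  (fun t => g' t - g t)^`()%classic = fun t => g'^`()%classic t - g^`()%classic t.
Proof. by move=> dg dg'; apply/funext => t; rewrite !derive1E deriveB. Qed.

Lemma normX_sub_ge a q q' e : 0 < a -> inX a q -> inX a q' ->
    normX a (fun t => q' t - q t) < e ->
  forall t, [/\ `|q' t - q t| <= e, `|q'^`()%classic t - q^`()%classic t| <= e &
    `|q'^`` t - q^`` t| <= e].
Proof.
move=> a0 qX qX' lt t.
have [[qT dq] dq1] := inX_smooth qX; have [[qT' dq'] dq1'] := inX_smooth qX'.
have e1 := derive1_sub dq dq'; have e2 := derive1_sub dq1 dq1'.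
have [] := @normX_ge R a (fun t => q' t - q t) _ _ t.
- split; [split|]; [by move=> u; rewrite qT qT' | by move=> u; apply: derivableB |].
  by move=> u; rewrite e1; apply: derivableB.
- rewrite e1 e2 => u; apply: cvgB; exact: (continuous_second a0).
rewrite e1 e2 => h0 h1 h2; split; apply/ltW; first exact: le_lt_trans h0 lt.
  exact: le_lt_trans h1 lt.
exact: le_lt_trans h2 lt.
Qed.

Lemma admissible_regular a q : 0 < a -> Xadm a q -> exists m w d,
  [/\ 0 < m, 0 < d, w <= m / 4, regular m w d q & exists2 e0, 0 < e0 &
    forall q', inX a q' -> normX a (fun t => q' t - q t) < e0 -> regular m w d q'].
Proof.
move=> a0 [qX mq _]; have [m m0 hm] := nondegenerate_bound a0 qX mq.
have [|d d0 hd] := @modulus R a q (m / 16) a0 qX; first by lra.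
(* [q] satisfies the bounds with [m] and [m / 16]. A perturbation of size [m / 32] costs at most
   [m / 16] in each, and [m / 16 + m / 16 = m / 8] is the quarter of [m / 2] that is allowed. *)
exists (m / 2), (m / 8), d; split; [by lra | by [] | by lra | | exists (m / 32); first by lra].
  split; first exact: inX_smooth qX.
    by move=> t; apply: le_trans (hm t); lra.
  by move=> s t st; apply: le_trans (hd s t st) _; lra.
move=> q' qX' /(normX_sub_ge a0 qX qX') close; split; first exact: inX_smooth qX'.
  have tri (A B C D : R) : `|C - A| <= m / 32 -> `|D - B| <= m / 32 -> m <= `|A| + `|B| ->
      m / 2 <= `|C| + `|D|.
    have := ler_normD (A - C) C; have := ler_normD (B - D) D.
    rewrite !subrK (distrC C) (distrC D).
    by move: `|A| `|B| `|C| `|D| => ? ? ? ?; lra.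
  by move=> t; have [_ c1 c2] := close t; exact: tri c1 c2 (hm t).
have tri (A B C D : R) : `|C - A| <= m / 32 -> `|D - B| <= m / 32 -> `|A - B| <= m / 16 ->
    `|C - D| <= m / 8.
  by rewrite !ler_norml => /andP[? ?] /andP[? ?] /andP[? ?]; apply/andP; split; lra.
move=> s t st; have [_ _ c1] := close s; have [_ _ c2] := close t.
exact: tri c1 c2 (hd s t st).
Qed.

Theorem structural_stability a q : 0 < a -> Xadm a q -> forall e, 0 < e ->
  exists2 de, 0 < de & forall q', Xadm a q' -> normX a (fun t => q' t - q t) < de ->
  exists2 F, crit_iso q q' F &
    forall x, crit q x -> `|F x - x| < e /\ `|q' (F x) - q x| < e.
Proof.
move=> a0 qA e e0; have [qX mq vq] := qA.
have [sq dq1] := inX_smooth qX; have [qT dq] := sq.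
have [m [w [d [m0 d0 wm rq [e1 e10 he1]]]]] := admissible_regular a0 qA.
have [n n0 hn] := crit_value_gap sq (regular_finite_crit m0 d0 wm rq).
pose l := normX a q + 1.
have hl t : `|q^`()%classic t| <= l.
  have [_ h _] := normX_ge a (inX_smooth qX) (continuous_second a0 qX) t.
  by apply: le_trans h _; rewrite /l; lra.
have l0 : 0 < l.
  have [h _ _] := normX_ge a (inX_smooth qX) (continuous_second a0 qX) 0.
  by have := normr_ge0 (q 0); rewrite /l; lra.
(* [v] is the budget for the change of a critical value: half for the displacement of the point,
   [l * r <= v / 2], and half for the change of the function, [f <= v / 2]. *)
have [v v0 [vn ve]] : exists2 v, 0 < v & 2 * v < n /\ v < e.
  exists (Num.min n e / 3); first by rewrite divr_gt0 // lt_min n0.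
  have : Num.min n e <= n by rewrite ge_min lexx.
  have : Num.min n e <= e by rewrite ge_min lexx orbT.
  by move=> h1 h2; split; lra.
have [r r0 [rd re rv]] : exists2 r, 0 < r & [/\ 2 * r < d, r < e & l * r <= v / 2].
  have v2 : 0 < v / 2 / l by rewrite !divr_gt0.
  exists (Num.min (Num.min (d / 3) (e / 2)) (v / 2 / l)).
    by rewrite !lt_min v2 !divr_gt0.
  set r := Num.min _ _.
  have r1 : r <= d / 3 by rewrite /r !ge_min lexx.
  have r2 : r <= e / 2 by rewrite /r !ge_min lexx orbT.
  have r3 : r <= v / 2 / l by rewrite /r !ge_min lexx orbT.
  by split; [lra | lra | rewrite mulrC -ler_pdivlMr].
have mr : 0 < m / 2 * r by rewrite mulr_gt0 // divr_gt0.
have [f f0 [f1 f2 f3 f4]] : exists2 f, 0 < f & [/\ f <= e1, f <= m / 4, f <= m / 2 * r & f <= v / 2].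
  exists (Num.min (Num.min e1 (m / 4)) (Num.min (m / 2 * r) (v / 2))).
    by rewrite !lt_min e10 mr !divr_gt0.
  by rewrite !ge_min !lexx !orbT.
exists f => // q' qA' lt; have [qX' _ _] := qA'.
have close := normX_sub_ge a0 qX qX' lt.
have close0 x t : `|t - x| <= r -> `|q' t - q x| <= v.
  move=> tx; have [h _ _] := close t; have h2 := lipschitz_derive1 dq hl t x.
  have h3 : l * `|t - x| <= l * r by apply: ler_wpM2l tx; apply: ltW.
  have := ler_distD (q t) (q' t) (q x).
  by move: h h2 h3; move: `|q' t - q t| `|q t - q x| `|q' t - q x| => A B C; lra.
have sep x y : crit q x -> crit q y -> q x = q y -> exists k, y = turn k x.
  move=> cx cy xy; have [i hi] := wrapE x; have [j hj] := wrapE y.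
  have : wrap x = wrap y.
    apply: vq; try exact: angle_wrap; try by apply/(crit_turn _ _ qT).
    by rewrite /wrap !periodic_turn.
  rewrite hi hj => h; exists (- j + i); rewrite -turnD h turnK //.
have [F iF hF] := close_crit_iso m0 r0 rd wm f2 f3 rq (he1 _ qX' (lt_le_trans lt f1))
  (fun t => let: And3 _ h _ := close t in h) (fun t => let: And3 _ _ h := close t in h)
  close0 sep hn vn.
exists F => // x cx; split; first exact: le_lt_trans (hF x cx) re.
by apply: le_lt_trans ve; apply: close0; apply: hF.
Qed.

End AdmissiblePerturbation.

(** * Lifetimes and total variation *)

Section Variation.
Context {R : realType}.
Implicit Types (q h g : R -> R) (s t x y c d : R) (k : int).

Local Notation T := (2 * pi : R).

(* Each arc [u i, v i] is cut out in turn, [h] being frozen to its common value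
   at the two ends; this removes at least the round trip to [x i] from the
   variation of [h], which is measured by [g], and leaves the later arcs intact. *)
Lemma sum_arcs_le_variation (I : eqType) (u x v d : I -> R) (A B : R) (s : seq I) h g :
    (forall a b, A <= a -> a <= b -> b <= B -> `|h a - h b| <= g b - g a) ->
    (forall i, i \in s -> [/\ A <= u i, u i < x i, x i < v i & v i <= B] /\
       h (u i) = d i /\ h (v i) = d i) ->
    pairwise (fun i j => [&& ~~ (u i < x j < v i), ~~ (u i < u j < v i) &
       ~~ (u i < v j < v i)]) s ->
    A <= B ->
  2 * (\sum_(i <- s) `|d i - h (x i)|) <= g B - g A.
Proof.
elim: s h g => [|i s IH] h g hg hs pw AB.
  by rewrite big_nil mulr0; apply: le_trans (hg A B _ _ _).
have [[Au ux xv vB] [hu hv]] := hs i (mem_head _ _).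
have uv : u i < v i := lt_trans ux xv.
pose h' t := if u i < t < v i then d i else h t.
pose g' t := if t <= u i then g t else if t < v i then g (u i) else g t - (g (v i) - g (u i)).
have hout t : ~~ (u i < t < v i) -> h' t = h t by rewrite /h' => /negbTE ->.
move: pw; rewrite pairwise_cons => /andP[/allP pi_ pw].
have := IH h' g' _ _ pw AB; rewrite [in X in _ -> _ -> X]/g'.
rewrite Au (lt_geF (lt_le_trans uv vB)) (le_gtF vB).
rewrite (eq_big_seq (fun j => `|d j - h (x j)|)); last first.
  by move=> j js; rewrite hout //; case/and3P: (pi_ j js).
rewrite big_cons => IH'.
have {IH'} : 2 * (\sum_(j <- s) `|d j - h (x j)|) <= g B - (g (v i) - g (u i)) - g A.
  apply: IH'.
    move=> a b Aa ab bB; rewrite /h' /g'.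
    have [au|ua] := leP a (u i); have [bu|ub] := leP b (u i) => /=.
    - exact: hg.
    - have [bv|vb] := ltP b (v i) => /=; first by rewrite -hu; apply: hg => //; lra.
      have h1 : `|h a - h (u i)| <= g (u i) - g a by apply: hg => //; lra.
      have h2 : `|h (v i) - h b| <= g b - g (v i) by apply: hg => //; lra.
      apply: le_trans (ler_distD (d i) _ _) _; rewrite -{1}hu -hv; lra.
    - by lra.
    - have [av|va] := ltP a (v i); have [bv|vb] := ltP b (v i) => /=.
      + by rewrite !subrr normr0.
      + have : `|h (v i) - h b| <= g b - g (v i) by apply: hg => //; lra.
        by rewrite hv; lra.
      + by lra.
      + have : `|h a - h b| <= g b - g a by apply: hg.
        by lra.
  move=> j js; have [h1 [h2 h3]] := hs j (mem_behead (s := i :: s) js).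
  by have /and3P[? ? ?] := pi_ j js; split => //; rewrite !hout.
have : `|h (u i) - h (x i)| <= g (x i) - g (u i) by apply: hg => //; lra.
have : `|h (x i) - h (v i)| <= g (v i) - g (x i) by apply: hg => //; lra.
rewrite hu hv [`|h (x i) - _|]distrC mulrDr.
by move: (\sum_(j <- s) _) => S; lra.
Qed.

(** Both ends of [M, M + T] are at least as high as [q y], so this level is reached on each side of
    the lift of [x]; the nearest such points bound the arc. *)
Lemma elder_arc q M x y : smooth q -> (forall t, q t <= q M) -> elder_pair q x y ->
  exists uxv : R * R * R, let: (u, X, v) := uxv in
    [/\ [/\ M <= u, u < X, X < v & v <= M + T], exists k, X = turn k x,
        q u = q y, q v = q y & forall s, u < s < v -> q s < q y].
Proof.
move=> [qT dq] hM [_ _ [x' [_ /andP[_ xy] _ _ _]]]; have cq := derivable_continuous dq.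
have [k /andP[k1 k2]] := lift_from M x.
have qX : q (turn k x) < q y by rewrite periodic_turn.
have [|v [/andP[v1 v2] qv hv]] := first_reach cq (ltW k2) qX; first by rewrite qT.
have [u [/andP[u1 u2] qu hu]] := last_reach cq k1 qX (hM y).
exists (u, turn k x, v); split => //; first by exists k.
move=> s /andP[s1 s2]; have [sX|Xs] := leP s (turn k x).
  by apply: hu; rewrite s1.
by apply: hv; rewrite ltW.
Qed.

(** Going through components avoids composing arcs with different lifts. *)
Lemma joined_le_trans q c x y z : smooth q ->
  joined (fun s => q s <= c) x y -> joined (fun s => q s <= c) z y ->
  joined (fun s => q s <= c) x z.
Proof.
move=> [qT _] /joined_component cxy /joined_component czy; apply: component_joined => //.
exact: connected_component_trans cxy (connected_component_sym czy).
Qed.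

(* Two elder pairs whose arcs share a point of low level have the same minimum,
   hence the same maximum: otherwise the higher arc contains the deeper minimum
   with which the lower pair merges. *)
Lemma elder_pair_inj q x y x2 y2 : smooth q -> distinct_critical_values q ->
    angle x -> angle y -> angle x2 -> angle y2 ->
    elder_pair q x y -> elder_pair q x2 y2 -> q y <= q y2 ->
    joined (fun s => q s < q y) x x2 -> joined (fun s => q s < q y) x2 x ->
  (x, y) = (x2, y2).
Proof.
move=> sq vq ax ay ax2 ay2 [mx my [x' [mx' /andP[x'x xy] lx lx' [j1 j2]]]].
move=> [mx2 my2 [_ [_ _ lx2 _ _]]] yy j j'; have [qT dq] := sq.
have qx : q x = q x2.
  apply/eqP; rewrite eq_le lx //=; apply: lx2.
  by apply: sub_joined j' => s sl; apply: lt_le_trans yy.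
have xE : x = x2 by apply: vq => //; apply: crit_local_min.
rewrite -xE; congr pair.
have [yy2|yy2|yE] := ltgtP (q y) (q y2).
- suff : q x2 <= q x' by rewrite -xE leNgt x'x.
  apply: lx2; rewrite -xE.
  by apply: sub_joined (joined_le_trans sq j1 j2) => s /= sl; apply: le_lt_trans yy2.
- by move: yy; rewrite leNgt yy2.
- by apply: vq => //; apply: crit_local_max.
Qed.

Lemma sum_lifetimes_H0 q (l : R) (s : seq (R * R)) : smooth q -> distinct_critical_values q ->
    (forall a b, `|q a - q b| <= l * `|a - b|) -> uniq s ->
    (forall p, p \in s -> H0_pairs q p) ->
  2 * (\sum_(p <- s) lifetime q p) <= l * T.
Proof.
move=> sq vq lip us sH; have [qT dq] := sq; have T0 := @twopi_gt0 R.
have [M hM] := global_max_exists sq.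
have el p : p \in s -> [/\ angle p.1, angle p.2 & elder_pair q p.1 p.2].
  by move=> /sH; case: p => x y /H0_pairsE => /(_ qT (derivable_continuous dq)).
have /choice[f hf] : forall p, exists uxv : R * R * R, p \in s ->
    let: (u, X, v) := uxv in
    [/\ [/\ M <= u, u < X, X < v & v <= M + T], exists k, X = turn k p.1,
        q u = q p.2, q v = q p.2 & forall t, u < t < v -> q t < q p.2].
  move=> p; have [/el[_ _ /(elder_arc sq hM)[uxv h]]|_] := boolP (p \in s).
    by exists uxv.
  by exists (0, 0, 0).
pose u p := (f p).1.1; pose X p := (f p).1.2; pose v p := (f p).2.
have {}hf p : p \in s -> [/\ [/\ M <= u p, u p < X p, X p < v p & v p <= M + T],
    exists k, X p = turn k p.1, q (u p) = q p.2, q (v p) = q p.2 &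
    forall t, u p < t < v p -> q t < q p.2].
  by move=> /hf; rewrite /u /X /v; case: (f p) => [[? ?] ?].
pose le_d (p p2 : R * R) := q p.2 <= q p2.2.
(* Lower death levels come first: an arc is removed before those that may contain it. *)
pose s' := sort le_d s.
have mem_s' p : (p \in s') = (p \in s) by rewrite mem_sort.
have le_d_tr : transitive le_d by move=> a b c; apply: le_trans.
have srt : pairwise le_d s'.
  rewrite -sorted_pairwise //; apply: sort_sorted => a b; exact: le_total.
have us' : pairwise (fun p p2 => p != p2) s' by rewrite -uniq_pairwise sort_uniq.
have qX p : p \in s -> q (X p) = q p.1.
  by move=> /hf[_ [k ->] _ _ _]; rewrite periodic_turn.
rewrite -(perm_big (P := predT) _ (permEl (perm_sort le_d s))) /=.
have -> : \sum_(p <- s') lifetime q p = \sum_(p <- s') `|q p.2 - q (X p)|.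
  by apply: eq_big_seq => p; rewrite mem_s' => ps; rewrite qX.
have -> : l * T = l * (M + T) - l * M by ring.
apply: (@sum_arcs_le_variation _ u X v (fun p => q p.2) M (M + T) s' q (fun t => l * t)).
- move=> a b Ma ab bM; apply: le_trans (lip a b) _.
  by rewrite distrC ger0_norm ?subr_ge0 // mulrBr.
- by move=> p; rewrite mem_s' => /hf[h _ h1 h2 _].
- apply: (@sub_in_pairwise _ (mem s') (fun p p2 => le_d p p2 && (p != p2))); last first.
  + by rewrite pairwise_relI srt.
  + by apply/allP.
  move=> p p2; rewrite /= !mem_s' => ps p2s /andP[dd ne].
  have [[_ uX Xv _] [k kE] qu qv hp] := hf p ps.
  have [[_ uX2 Xv2 _] [k2 k2E] qu2 qv2 hp2] := hf p2 p2s.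
  (* Inside the arc of [p] the values are below [q p.2], while the ends of the later arc have height
     [q p2.2], which is at least [q p.2]. *)
  apply/and3P; split; apply/negP => hh; last 2 first.
  + by have := hp _ hh; rewrite qu2 ltNge [_ <= _]dd.
  + by have := hp _ hh; rewrite qv2 ltNge [_ <= _]dd.
  (* If the lifted minimum of [p2] were inside, the two minima would be joined below [q p.2] and the
     pairs would coincide. *)
  move/negP: ne; apply; apply/eqP.
  have [a1 a2 e] := el p ps; have [a12 a22 e2] := el p2 p2s.
  have qt j t : q (turn j t) < q p.2 <-> q t < q p.2 by rewrite periodic_turn.
  rewrite (surjective_pairing p) (surjective_pairing p2).
  move: hh => /andP[h1 h2].
  have J a b : u p < a < v p -> u p < b < v p -> joined (fun s => q s < q p.2) a b.
    move=> /andP[? ?] /andP[? ?]; exists 0 => t; rewrite turn0 => -[/andP[? ?]|/andP[? ?]].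
      by apply: hp; apply/andP; split; lra.
    by apply: hp; apply/andP; split; lra.
  apply: (elder_pair_inj sq vq) => //.
    have : joined (fun s => q s < q p.2) (X p) (X p2) by apply: J; apply/andP.
    by rewrite kE k2E joined_turnr joined_turnl.
  have : joined (fun s => q s < q p.2) (X p2) (X p) by apply: J; apply/andP.
  by rewrite kE k2E joined_turnr joined_turnl.
- by lra.
Qed.

End Variation.

(** * Cyclic order and the penalty *)

Section Correspondence.
Context {R : realType}.
Implicit Types (q : R -> R) (F : R -> R) (a s t u v x y z c d m w r e : R) (i j k : int).

Local Notation T := (2 * pi : R).

Lemma angle_turn_le i j u v : angle (turn i u) -> angle (turn j v) -> u < v -> j <= i.
Proof.
have T0 := @twopi_gt0 R; rewrite /angle /turn => /andP[u0 uT] /andP[v0 vT] uv.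
have : (j%:~R : R) < i%:~R + 1 by rewrite -(ltr_pM2l T0); lra.
by rewrite -[X in _ + X](_ : 1%:~R = 1) // -rmorphD ltr_int ltzD1.
Qed.

(** The window is shorter than a turn, so the origin of angles cuts it at most once; the three cases
    of [cyclic] tell where. *)
Lemma cyclic_wrap u v w : u < v -> v < w -> w < u + T -> cyclic (wrap u) (wrap v) (wrap w).
Proof.
move=> uv vw wu; have [i iE] := wrapE u; have [j jE] := wrapE v; have [k kE] := wrapE w.
have := angle_wrap u; have := angle_wrap v; have := angle_wrap w.
rewrite iE jE kE => aw av au.
have ji := angle_turn_le au av uv; have kj := angle_turn_le av aw vw.
have ik : i - 1 <= k.
  apply: (@angle_turn_le k (i - 1) w (turn 1 u)) => //; first by rewrite turnD subrK.
  by rewrite /turn mulr1.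
rewrite /turn; have [ki|ki] := eqVneq k i.
  have jiE : j = i by apply/eqP; rewrite eq_le ji -ki.
  by apply: Or31; rewrite ki jiE !ltrD2r uv.
have kE1 : k = i - 1.
  by apply/eqP; rewrite eq_le ik andbT lerBrDr lezD1 lt_neqAle ki (le_trans kj ji).
have i1 : (k%:~R : R) = i%:~R - 1 by rewrite kE1 rmorphB.
have [jiE|jiN] := eqVneq j i.
  by apply: Or33; rewrite i1 jiE ltrD2r uv andbT; lra.
have jkE : j = k.
  by apply/eqP; rewrite eq_le kj andbT kE1 lerBrDr lezD1 lt_neqAle jiN.
by apply: Or32; rewrite jkE ltrD2r vw i1 /=; lra.
Qed.

Lemma cyclic_rot x y z : cyclic x y z <-> cyclic y z x.
Proof. by split=> -[] ?; [apply: Or33|apply: Or31|apply: Or32|apply: Or32|apply: Or33|apply: Or31]. Qed.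

Lemma arc_dist_wrap x y r : angle x -> `|y - x| < r -> r <= T -> arc_dist x (wrap y) < r.
Proof.
have T0 := @twopi_gt0 R; move=> /andP[x0 xT]; rewrite ltr_norml => /andP[y1 y2] rT.
have [k kE] := wrapE y; have /andP[w0 wT] := angle_wrap y.
have k1 : -2 < k.
  rewrite -(@ltr_int R) -(ltr_pM2l T0); rewrite kE /turn in w0 wT.
  by rewrite (_ : (-2)%:~R = -2 :> R) //; lra.
have k2 : k < 2.
  rewrite -(@ltr_int R) -(ltr_pM2l T0); rewrite kE /turn in w0 wT.
  by rewrite (_ : 2%:~R = 2 :> R) //; lra.
rewrite /arc_dist gt_min kE /turn in w0 wT *.
have [->|[->|->]] : k = 0 \/ k = 1 \/ k = -1 by lia.
- by rewrite mulr0 addr0; apply/orP; left; rewrite ltr_norml; apply/andP; split; lra.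
- rewrite (_ : 1%:~R = 1 :> R) // mulr1; apply/orP; right.
  by rewrite ltrBlDr -ltrBlDl; have := ler_norm (-(x - (y + T))); rewrite normrN; lra.
- rewrite (_ : (-1)%:~R = -1 :> R) // mulrN1; apply/orP; right.
  by have := ler_norm (x - (y - T)); lra.
Qed.

(** On a line a nondegenerate critical point is always an extremum, so a bijection of critical
    points is one of local extrema. *)
Lemma local_extremaE a q x : 0 < a -> Xadm a q -> local_extrema q x <-> angle x /\ crit q x.
Proof.
move=> a0 qA; have [qX _ _] := qA; have [[_ dq] _] := inX_smooth qX; split.
  by move=> [ax [h|h]]; split => //; [exact: crit_local_min | exact: crit_local_max].
move=> [ax cx]; split => //.
have [m [w [d [m0 d0 wm rq _]]]] := admissible_regular a0 qA.
have curv := regular_crit_curv rq cx.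
have [q0|q0|q0] := ltgtP 0 (q^`()%classic^`()%classic x).
- by left; apply/(regular_min m0 d0 wm rq).
- by right; apply/(regular_max m0 d0 wm rq).
- by rewrite -q0 normr0 leNgt m0 in curv.
Qed.

Lemma wrap_iso_inj q q' F x y : periodic q T -> crit_iso q q' F -> angle x -> angle y ->
  crit q x -> crit q y -> wrap (F x) = wrap (F y) -> x = y.
Proof.
move=> qT iF ax ay cx cy; have [i ->] := wrapE (F x); have [j ->] := wrapE (F y) => e.
have {}e : F x = F (turn (- i + j) y) by rewrite (iso_turn iF) // -turnD -e turnK.
apply: (angle_turn_eq ax ay (k := - i + j)).
have cy' : crit q (turn (- i + j) y) by apply/crit_turn.
by apply/eqP; rewrite eq_le -(iso_le iF) // -[X in _ && X](iso_le iF) // e lexx.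
Qed.

(** Makes the hypothesis on the order index, which concerns correspondences of angles, applicable to
    the isomorphism built on the line. *)
Lemma iso_correspondence a q q' F r : 0 < a -> Xadm a q -> Xadm a q' -> crit_iso q q' F ->
    r <= T -> (forall x, crit q x -> `|F x - x| < r) ->
  extrema_correspondence r q q' (fun x => wrap (F x)).
Proof.
move=> a0 qA qA' iF rT hF; have [qX _ _] := qA; have [qX' _ _] := qA'.
have [[qT dq] _] := inX_smooth qX; have [[qT' dq'] _] := inX_smooth qX'.
have E x := local_extremaE x a0 qA; have E' x := local_extremaE x a0 qA'.
have Flt x y : crit q x -> crit q y -> x < y -> F x < F y.
  by move=> cx cy; rewrite !ltNge (iso_le iF).
have cyc x y z : angle x -> angle z -> crit q x -> crit q y -> crit q z -> x < y < z ->
    cyclic (wrap (F x)) (wrap (F y)) (wrap (F z)).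
  move=> /andP[x0 xT] /andP[z0 zT] cx cy cz /andP[xy yz].
  apply: cyclic_wrap; [exact: Flt | exact: Flt |].
  have -> : F x + T = F (turn 1 x) by rewrite (iso_turn iF) // /turn mulr1.
  apply: Flt => //; first by apply/crit_turn.
  by rewrite /turn mulr1; lra.
split.
- split.
  + move=> x /E[ax cx]; apply/E'; split; first exact: angle_wrap.
    by apply/crit_turn => //; apply: (iso_crit iF).
  + move=> x y /set_mem/E[ax cx] /set_mem/E[ay cy]; exact: (wrap_iso_inj qT iF).
  + move=> y /E'[ay cy]; have [x cx xy] := iso_surj iF cy.
    exists (wrap x); first by apply/E; split; [exact: angle_wrap | apply/crit_turn].
    have [i iE] := wrapE x; rewrite iE (iso_turn iF) // xy.
    have [j jE] := wrapE (turn i y).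
    by apply: (angle_turn_eq (angle_wrap _) ay (k := j + i)); rewrite jE turnD.
- by move=> x /E[ax cx] h; apply: local_min_turn => //; apply/(iso_min iF).
- by move=> x /E[ax cx] h; apply: local_max_turn => //; apply/(iso_max iF).
- move=> x y z /E[ax cx] /E[ay cy] /E[az cz] [] h.
  + exact: cyc.
  + by apply/cyclic_rot; apply: cyc.
  + by apply/cyclic_rot/cyclic_rot; apply: cyc.
- by move=> x /E[ax cx]; apply: arc_dist_wrap => //; apply: hF.
Qed.

End Correspondence.

(** * Bounds and continuity of the penalty *)

Section Penalty.
Context {R : realType}.
Implicit Types (q : R -> R) (F : R -> R) (a r e : R) (kappa : (R -> R) -> R * R -> nat).

Local Notation T := (2 * pi : R).

Lemma lifetime_ge0 q (p : R * R) : 0 <= lifetime q p.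
Proof. exact: normr_ge0. Qed.

Lemma aug_pairs_finite a q : 0 < a -> Xadm a q -> finite_set (aug_pairs q).
Proof.
move=> a0 qA; have [qX _ _] := qA; have [sq _] := inX_smooth qX.
have [m [w [d [m0 d0 wm rq _]]]] := admissible_regular a0 qA.
have fin := regular_finite_crit m0 d0 wm rq.
apply: sub_finite_set (finite_setX fin fin) => -[x y] /(aug_pairs_crit sq)[ax ay cx cy].
by split.
Qed.

Lemma distinct_critical_valuesN q : smooth q -> distinct_critical_values q ->
  distinct_critical_values (fun t => - q t).
Proof.
move=> [_ dq] vq s t as_ at_ cs ct e; apply: vq => //; [exact/critN|exact/critN|].
by apply: oppr_inj.
Qed.

(** Distinct critical values leave only one global pair, so [s] has at most one element. *)
Lemma sum_global_pair q (l : R) (s : seq (R * R)) : smooth q -> distinct_critical_values q ->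
    (forall u v, `|q u - q v| <= l * `|u - v|) -> uniq s ->
    (forall p, p \in s -> global_pair q p) ->
  \sum_(p <- s) lifetime q p <= l * T.
Proof.
move=> sq vq lip us sG; have T0 := @twopi_gt0 R; have [qT dq] := sq.
have l0 : 0 <= l by have := lip 0 1; rewrite sub0r normrN normr1 mulr1; apply: le_trans.
case: s us sG => [|p [|p2 s]] us sG; first by rewrite big_nil mulr_ge0 // ltW.
  rewrite big_seq1 /lifetime; apply: le_trans (lip _ _) _.
  have := sG p (mem_head _ _); case: p {sG us} => x y [/andP[x0 xT] /andP[y0 yT] _] /=.
  by apply: ler_wpM2l => //; rewrite ler_norml; apply/andP; split; lra.
have p1 := sG p (mem_head _ _).
have p2' : global_pair q p2 by apply: sG; rewrite !in_cons eqxx orbT.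
suff pE : p = p2 by rewrite pE /= mem_head in us.
case: p p2 p1 p2' {us sG} => [x y] [x2 y2] p1 p2.
have [ax ay cx cy] := aug_pairs_crit sq (or_intror p1).
have [ax2 ay2 cx2 cy2] := aug_pairs_crit sq (or_intror p2).
have [_ _ h] := p1; have [_ _ h2] := p2.
have -> : x = x2.
  apply: vq => //; apply/eqP; rewrite eq_le.
  by have /andP[-> _] := h x2; have /andP[-> _] := h2 x.
congr pair; apply: vq => //; apply/eqP; rewrite eq_le.
by have /andP[_ ->] := h y2; have /andP[_ ->] := h2 y.
Qed.

Lemma sum_lifetimes a q : 0 < a -> Xadm a q ->
  \sum_(p \in aug_pairs q) lifetime q p <= 2 * T * normX a q.
Proof.
move=> a0 qA; have [qX _ vq] := qA; have [sq dq1] := inX_smooth qX.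
have [qT dq] := sq; have fin := aug_pairs_finite a0 qA.
have hl t : `|q^`()%classic t| <= normX a q.
  by have [_ h _] := normX_ge a (inX_smooth qX) (continuous_second a0 qX) t.
have lip := lipschitz_derive1 dq hl.
have lipN u v : `|- q u - - q v| <= normX a q * `|u - v|.
  by rewrite -opprD normrN; apply: lip.
rewrite fsbig_finite //; set s := finmap.enum_fset _.
have us : uniq s by apply: finmap.fset_uniq.
have sA p : p \in s -> aug_pairs q p by rewrite in_fset_set // => /set_mem.
pose A1 p := `[< H0_pairs q p >]; pose A2 p := `[< H0_pairs (fun t => - q t) p >].
pose A3 p := `[< global_pair q p >].
have lN p : lifetime (fun t => - q t) p = lifetime q p.
  by rewrite /lifetime -opprD normrN.
have h1 : 2 * (\sum_(p <- [seq p <- s | A1 p]) lifetime q p) <= normX a q * T.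
  apply: sum_lifetimes_H0 => //; first exact: filter_uniq.
  by move=> p; rewrite mem_filter => /andP[/asboolP].
have h2 : 2 * (\sum_(p <- [seq p <- s | A2 p]) lifetime q p) <= normX a q * T.
  under eq_bigr do rewrite -lN.
  apply: sum_lifetimes_H0 => //; [exact: smoothN | exact: distinct_critical_valuesN | exact: filter_uniq |].
  by move=> p; rewrite mem_filter => /andP[/asboolP].
have h3 : \sum_(p <- [seq p <- s | A3 p]) lifetime q p <= normX a q * T.
  apply: sum_global_pair => //; first exact: filter_uniq.
  by move=> p; rewrite mem_filter => /andP[/asboolP].
(* The three families may overlap: each pair is counted at least once on the right. Their bounds are
   one half, one half and one times [normX a q * T]. *)
have : \sum_(p <- s) lifetime q p <= \sum_(p <- [seq p <- s | A1 p]) lifetime q p +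
   \sum_(p <- [seq p <- s | A2 p]) lifetime q p + \sum_(p <- [seq p <- s | A3 p]) lifetime q p.
  rewrite !big_filter [X in _ <= X + _ + _]big_mkcond [X in _ <= _ + X + _]big_mkcond.
  rewrite [X in _ <= _ + _ + X]big_mkcond -!big_split /= big_seq [X in _ <= X]big_seq.
  apply: ler_sum => p /sA; have l0 := lifetime_ge0 q p; rewrite /A1 /A2 /A3.
  move=> [[|]|] /asboolT ->; do ?case: ifP => _; lra.
by lra.
Qed.

Section Weighted.
Variables (a : R) (a0 : 0 < a).

Lemma penalty_bounded_below (w : (R -> R) -> R * R -> R) :
  (forall q, Xadm a q -> forall p, aug_pairs q p -> 0 <= w q p) ->
  bounded_below a (penalty w).
Proof.
move=> w0; exists 0 => q qA; apply: fsumr_ge0 => p pA.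
by rewrite mulr_ge0 ?lifetime_ge0 // w0.
Qed.

Variables (kappa : (R -> R) -> R * R -> nat) (tau beta : R).
Hypotheses (tau0 : 0 < tau) (beta0 : 0 < beta).

Lemma denominator_ge1 q p : 1 <= 1 + beta * lifetime q p.
Proof. by rewrite lerDl mulr_ge0 ?lifetime_ge0 // ltW. Qed.

Lemma order_weight_ge0 q p : 0 <= order_weight kappa tau beta q p.
Proof.
rewrite /order_weight mulr_ge0 // divr_ge0 ?(ltW tau0) //.
exact: le_trans ler01 (denominator_ge1 q p).
Qed.

Lemma order_weight_le q p : order_weight kappa tau beta q p <= (kappa q p).+1%:R * tau.
Proof.
rewrite /order_weight ler_wpM2l // ler_pdivrMr.
  by rewrite ler_peMr ?denominator_ge1 // ltW.
exact: lt_le_trans ltr01 (denominator_ge1 q p).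
Qed.

Lemma order_penalty_locally_bounded : order_factor_bounded a kappa ->
  locally_bounded a (penalty (order_weight kappa tau beta)).
Proof.
have T0 := @twopi_gt0 R; move=> kb r r0; have [C C0 hC] := kb r r0.
exists (C * tau * (2 * T * r)); first by rewrite !mulr_gt0 // pi_gt0.
move=> q qA qr; have fin := aug_pairs_finite a0 qA.
have h : penalty (order_weight kappa tau beta) q <=
    C * tau * (\sum_(p \in aug_pairs q) lifetime q p).
  rewrite /penalty !fsbig_finite // big_distrr /= big_seq [X in _ <= X]big_seq.
  apply: ler_sum => p; rewrite in_fset_set // => /set_mem pA.
  apply: ler_wpM2r; first exact: lifetime_ge0.
  apply: le_trans (order_weight_le q p) _; apply: ler_wpM2r; first exact: ltW.
  exact: hC.
apply: le_trans h _; apply: ler_wpM2l; first by rewrite mulr_ge0 ?ltW.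
apply: le_trans (sum_lifetimes a0 qA) _; apply: ler_wpM2l => //.
by rewrite mulr_ge0 // ltW.
Qed.

Lemma weighted_lifetime_lipschitz (l l' : R) : 0 <= l -> 0 <= l' ->
  `|tau / (1 + beta * l') * l' - tau / (1 + beta * l) * l| <= tau * `|l' - l|.
Proof.
move=> h h'; have b0 := beta0; have t0 := tau0.
have d1 : 1 <= 1 + beta * l by rewrite lerDl mulr_ge0 // ltW.
have d2 : 1 <= 1 + beta * l' by rewrite lerDl mulr_ge0 // ltW.
have n1 : 1 + beta * l != 0 by rewrite gt_eqF // (lt_le_trans ltr01).
have n2 : 1 + beta * l' != 0 by rewrite gt_eqF // (lt_le_trans ltr01).
(* The difference is explicit, and the product of the two denominators is at least 1. *)
have -> : tau / (1 + beta * l') * l' - tau / (1 + beta * l) * l =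
    tau * (l' - l) * ((1 + beta * l) * (1 + beta * l'))^-1 by field; rewrite n1 n2.
have dd : 1 <= (1 + beta * l) * (1 + beta * l') by apply: mulr_ege1.
rewrite normrM normrM (gtr0_norm tau0) ler_piMr ?mulr_ge0 ?(ltW tau0) //.
by rewrite normfV ger0_norm ?(le_trans ler01) // invf_le1 // (lt_le_trans ltr01).
Qed.

Lemma order_penalty_continuous : order_locally_preserved a kappa ->
  continuous_on_Xadm a (penalty (order_weight kappa tau beta)).
Proof.
have T0 := @twopi_gt0 R; have t0 := tau0; move=> kp q qA e e0.
have [rho [de [rho0 de0 hk]]] := kp q qA.
have [qX _ _] := qA; have [sq _] := inX_smooth qX; have fin := aug_pairs_finite a0 qA.
pose N := \sum_(p \in aug_pairs q) ((kappa q p).+1%:R * tau).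
have N0 : 0 <= N by apply: fsumr_ge0 => p _; rewrite mulr_ge0 // ltW.
(* Both endpoint values of a pair move by less than [r], so a lifetime moves by at most [2 * r] and
   the penalty by at most [2 * r * N]; the [+ 1] covers [N = 0] and makes the final bound strict. *)
pose r := Num.min (Num.min rho T) (e / (2 * N + 1)).
have r0 : 0 < r by rewrite !lt_min rho0 T0 divr_gt0 //; lra.
have [de2 de20 hF] := structural_stability a0 qA r0.
exists (Num.min de de2); first by rewrite lt_min de0.
move=> q' qA'; rewrite lt_min => /andP[n1 n2].
have [qX' _ _] := qA'; have [sq' _] := inX_smooth qX'.
have [F iF Fr] := hF q' qA' n2.
have rT : r <= rho /\ r <= T by rewrite /r !ge_min !lexx !orbT.
have re : r * (2 * N + 1) <= e.
  rewrite -ler_pdivlMr; last by lra.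
  by rewrite /r ge_min lexx orbT.
have corr : extrema_correspondence rho q q' (fun x => wrap (F x)).
  have [c1 c2 c3 c4 c5] := iso_correspondence a0 qA qA' iF rT.2 (fun x cx => (Fr x cx).1).
  by split => // x ex; apply: lt_le_trans (c5 x ex) rT.1.
pose h (p : R * R) := (wrap (F p.1), wrap (F p.2)).
have augE x y : aug_pairs q (x, y) -> aug_pairs q' (wrap (F x), wrap (F y)).
  move=> pA; have [ax ay cx cy] := aug_pairs_crit sq pA.
  exact/(iso_aug_pairs sq sq' iF).
have hb : set_bij (aug_pairs q) (aug_pairs q') h.
  split.
  - by move=> [x y] /augE.
  - move=> [x y] [x2 y2] /set_mem pA /set_mem pA2 [e1 e2].
    have [ax ay cx cy] := aug_pairs_crit sq pA.
    have [ax2 ay2 cx2 cy2] := aug_pairs_crit sq pA2.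
    by congr pair; apply: (wrap_iso_inj _ iF) => //; case: sq.
  - move=> [x y] pA'; have [ax ay cx cy] := aug_pairs_crit sq' pA'.
    have [[_ _ sf] _ _ _ _] := corr.
    have [u /(local_extremaE _ a0 qA)[au cu] ux] := sf x ((local_extremaE _ a0 qA').2 (conj ax cx)).
    have [v /(local_extremaE _ a0 qA)[av cv] vy] := sf y ((local_extremaE _ a0 qA').2 (conj ay cy)).
    exists (u, v); last by rewrite /h /= ux vy.
    by apply/(iso_aug_pairs sq sq' iF) => //; rewrite ux vy.
have term p : aug_pairs q p ->
    `|order_weight kappa tau beta q' (h p) * lifetime q' (h p) -
      order_weight kappa tau beta q p * lifetime q p| <= 2 * r * ((kappa q p).+1%:R * tau).
  case: p => x y pA; have [ax ay cx cy] := aug_pairs_crit sq pA.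
  (* Corresponding pairs have equal order index, so this factor comes out and only the lifetimes are
     compared. *)
  rewrite /order_weight /h /= (hk q' qA' n1 _ corr x y pA (augE x y pA)).
  rewrite -!(mulrA _.+1%:R) -mulrBr normrM normr_nat.
  have -> (K : R) : 2 * (r * (K * tau)) = K * (2 * r * tau) by ring.
  apply: ler_wpM2l => //.
  apply: le_trans (weighted_lifetime_lipschitz (lifetime_ge0 _ _) (lifetime_ge0 _ _)) _.
  rewrite [X in X <= _]mulrC; apply: ler_wpM2r; first exact: ltW.
  rewrite /lifetime /= /wrap; have [qT' _] := sq'; rewrite !periodic_turn //.
  have := (Fr x cx).2; have := (Fr y cy).2.
  move: (q' (F x)) (q' (F y)) (q x) (q y) => A B C D.
  move=> h1 h2; apply: le_trans (ler_dist_dist _ _) _.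
  by move: h1 h2; rewrite ler_norml !ltr_norml => /andP[? ?] /andP[? ?]; apply/andP; split; lra.
rewrite /penalty (reindex_fsbig h _ _ _ hb) !fsbig_finite // -sumrB.
apply: le_lt_trans (ler_norm_sum _ _ _) _.
apply: (@le_lt_trans _ _ (2 * r * N)); last first.
  by move: re; rewrite mulrDr mulr1; move: r0; lra.
rewrite /N fsbig_finite // big_distrr /= big_seq [X in _ <= X]big_seq.
by apply: ler_sum => p; rewrite in_fset_set // => /set_mem; apply: term.
Qed.

End Weighted.

Lemma lifetime_weightE (tau beta : R) : lifetime_weight tau beta = order_weight (fun _ _ => 0%N) tau beta.
Proof. by apply/funext => q; apply/funext => p; rewrite /order_weight mul1r. Qed.

Lemma zero_order_factor_bounded a : order_factor_bounded a (fun (_ : R -> R) _ => 0%N).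
Proof. by move=> r _; exists 1. Qed.

Lemma zero_order_locally_preserved a : order_locally_preserved a (fun (_ : R -> R) _ => 0%N).
Proof. by move=> q _; exists 1, 1; split. Qed.

Lemma order_penalty a kappa (tau beta : R) : 0 < a -> 0 < tau -> 0 < beta ->
    order_factor_bounded a kappa -> order_locally_preserved a kappa ->
  [/\ bounded_below a (penalty (order_weight kappa tau beta)),
      locally_bounded a (penalty (order_weight kappa tau beta)) &
      continuous_on_Xadm a (penalty (order_weight kappa tau beta))].
Proof.
move=> a0 t0 b0 kb kp; split.
- by apply: penalty_bounded_below => q _ p _; apply: order_weight_ge0.
- exact: order_penalty_locally_bounded.
- exact: order_penalty_continuous.
Qed.

End Penalty.

Theorem theorem4p3 (R : realType) (a : R) (ha : 0 < a < 1) :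
  (forall w : (R -> R) -> R * R -> R,
     (forall q, Xadm a q -> forall p, aug_pairs q p -> 0 <= w q p) ->
     bounded_below a (penalty w)) /\
  (forall tau beta : R, 0 < tau -> 0 < beta ->
     [/\ bounded_below a (penalty (lifetime_weight tau beta)),
         locally_bounded a (penalty (lifetime_weight tau beta)) &
         continuous_on_Xadm a (penalty (lifetime_weight tau beta))]) /\
  (forall (kappa : (R -> R) -> R * R -> nat) (tau beta : R),
     0 < tau -> 0 < beta ->
     order_factor_bounded a kappa -> order_locally_preserved a kappa ->
     [/\ bounded_below a (penalty (order_weight kappa tau beta)),
         locally_bounded a (penalty (order_weight kappa tau beta)) &
         continuous_on_Xadm a (penalty (order_weight kappa tau beta))]).
Proof.
have a0 : 0 < a by case/andP: ha.
split; first exact: penalty_bounded_below.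
split=> [tau beta t0 b0|kappa tau beta t0 b0 kb kp]; last exact: order_penalty.
rewrite lifetime_weightE; apply: order_penalty => //.
  exact: zero_order_factor_bounded.
exact: zero_order_locally_preserved.
Qed.
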